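(* Let $(\mathbf{S}_t)_{t\ge0}$ be a branching-stable process with positive scaling exponent $\alpha>0$ (that is, $\varepsilon=+1$). (i) If $\alpha>2$, then $\mathbf{S}_1$ is degenerate, i.e. almost surely all the atoms of $\mathbf{S}_1$ are located at $0$. (ii) If $0<\alpha\le2$ and $\mathbf{S}_1$ is not degenerate, then there exists an $\alpha$-stable Lévy process $(\xi_t)_{t\ge0}$ such that $\mathbf{S}_t$ is reduced to a single atom at $\xi_t$, viz. $\mathbf{S}_t=\delta_{\xi_t}$ for all $t\ge0$, almost surely.
   Context: $\mathcal{P}$ is the space of non-decreasing sequences $\mathbf{x}=(x_k)_{k\ge1}$ in $(-\infty,\infty]$ with $\lim_{k\to\infty}x_k=\infty$, endowed with the topology of pointwise convergence. It is identified with the space of locally finite point measures on $\mathbb{R}$ giving finite mass to $(-\infty,0]$, via $\mathbf{x}\simeq\sum_{k\ge1}\delta_{x_k}$ with the convention $\delta_\infty=0$. For $y\in\mathbb{R}$, $y+\mathbf{x}=(y+x_k)_{k\ge1}$; for $c>0$, $c\mathbf{x}=(cx_k)_{k\ge1}$; when $x=\infty$, $x+\mathbf{x}$ is the empty measure. $\bigsqcup$ denotes superposition (sum of point measures). For $\varepsilon\in\{+1,-1\}$ and $\alpha>0$, a branching-stable process with scaling exponent $\varepsilon\alpha$ is a process $\mathbf{S}=(\mathbf{S}_t)_{t\ge0}$ with càdlàg paths in $\mathcal{P}$, with $\mathbf{S}_0=\delta_0$, such that: (a) there is $\vartheta\ge0$ with $\mathbb{E}\big(\int e^{-\vartheta x}\,\mathbf{S}_1(dx)\big)<\infty$;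 (b) (branching property) for every $r>0$ there is a sequence $(\mathbf{S}^{(k)})_{k\ge1}$ of i.i.d. copies of $\mathbf{S}$, independent of $(\mathbf{S}_s)_{0\le s\le r}$ (on a possibly enlarged probability space), such that $\mathbf{S}_{t+r}=\bigsqcup_{k\ge1}(x_k+\mathbf{S}^{(k)}_t)$ for every $t\ge0$, with $(x_k)_{k\ge1}=\mathbf{S}_r$; (c) (self-similarity) for every $c>0$, $(\mathbf{S}_{c^{\varepsilon\alpha}t})_{t\ge0}$ and $(c\,\mathbf{S}_t)_{t\ge0}$ have the same distribution. An $\alpha$-stable Lévy process is understood in the strict sense: a real-valued Lévy process $(\xi_t)_{t\ge0}$, not identically $0$, such that $(\xi_{c^\alpha t})_{t\ge0}$ and $(c\,\xi_t)_{t\ge0}$ have the same law for every $c>0$. *)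

(* Defs.v *)
From HB Require Import structures.
From mathcomp Require Import all_boot all_order all_algebra.
From mathcomp Require Import all_classical all_reals all_analysis.
From mathcomp Require Import measurable_realfun.

Set Implicit Arguments.
Unset Strict Implicit.
Unset Printing Implicit Defensive.

Import Order.TTheory GRing.Theory Num.Theory.
Import numFieldNormedType.Exports.

Local Open Scope classical_set_scope.
Local Open Scope ring_scope.

(* Processes are indexed by R, but only times t >= 0 are ever constrained.
   Sequences (x_k)_(k >= 1) are indexed from 0, so x 0 is the leftmost atom. *)

Section path_regularity.
Context {R : realType} {T : topologicalType}.

Definition cadlag_in (D : set T) (f : R -> T) : Prop :=
  [/\ forall t : R, 0 <= t -> D (f t),
      forall t : R, 0 <= t -> f @ t^'+ --> f t &
      forall t : R, 0 < t -> exists2 l, D l & f @ t^'- --> l].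

End path_regularity.

Section laws_and_independence.
Context {R : realType}.

(* The sigma-algebra on the path space I -> E generated by the evaluations at
   the indices in D; the law of a process is its image measure there. *)
Definition path_sigma {I : Type} {dE} {E : measurableType dE} (D : set I) :
    set (set (I -> E)) :=
  <<s [set B | exists i A,
         [/\ D i, measurable A & B = [set p : I -> E | A (p i)]] ]>>.

Definition same_law {I : Type} {dE} {E : measurableType dE} (D : set I)
    {d1} {T1 : measurableType d1} (P1 : probability T1 R) (X : I -> T1 -> E)
    {d2} {T2 : measurableType d2} (P2 : probability T2 R) (Y : I -> T2 -> E) :
    Prop :=
  forall B, path_sigma D B ->
    P1 [set w | B (X ^~ w)] = P2 [set w | B (Y ^~ w)].

(* The sigma-algebra on T generated by the random variables X i, D i. *)
Definition sigma_of {T I : Type} {dE} {E : measurableType dE} (D : set I)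
    (X : I -> T -> E) : set (set T) :=
  <<s [set B | exists i A, [/\ D i, measurable A & B = X i @^-1` A] ]>>.

Definition independent {d} {T : measurableType d} (P : probability T R)
    (F G : set (set T)) : Prop :=
  forall A B, F A -> G B -> P (A `&` B) = (P A * P B)%E.

Definition mutually_independent {J : choiceType} {d} {T : measurableType d}
    (P : probability T R) (F : J -> set (set T)) : Prop :=
  forall (s : seq J) (A : J -> set T), uniq s ->
    (forall j, j \in s -> F j (A j)) ->
    P (\bigcap_(j in [set` s]) A j) = (\prod_(j <- s) P (A j))%E.

End laws_and_independence.

Section point_configurations.
Context {R : realType}.

(* [{ptws nat -> \bar R}] carries the topology of pointwise convergence. *)
Definition Pspace : set {ptws nat -> \bar R} :=
  [set x | [/\ forall k, x k != -oo%E,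
               forall m n, (m <= n)%N -> (x m <= x n)%E &
               x @ \oo --> +oo%E] ].

Definition point_measure (x : nat -> \bar R) : {measure set R -> \bar R} :=
  mseries (fun k => if x k is r%:E then dirac r : {measure set R -> \bar R}
                    else mzero) 0.

Definition translate (y : \bar R) (x : nat -> \bar R) : nat -> \bar R :=
  fun k => (y + x k)%E.

Definition dilate (c : R) (x : nat -> \bar R) : nat -> \bar R :=
  fun k => (c%:E * x k)%E.

(* The element of the space corresponding to the Dirac mass at y. *)
Definition single_atom (y : R) : nat -> \bar R :=
  fun k => if k is 0%N then y%:E else +oo%E.

Definition is_superposition (z : nat -> \bar R)
    (x : nat -> nat -> \bar R) : Prop :=
  forall A : set R, measurable A ->
    point_measure z A = (\sum_(0 <= k <oo) point_measure (x k) A)%E.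

End point_configurations.

Section branching_stable_processes.
Context {R : realType}.

(* A random configuration is measured through its coordinates, which generate
   the Borel sigma-algebra of the pointwise topology; hence a process with
   values in Pspace is read as a family indexed by (time, coordinate). *)
Definition coordinates {T : Type} (S : R -> T -> nat -> \bar R) :
    R * nat -> T -> \bar R :=
  fun i w => S i.1 w i.2.

Definition Pspace_cadlag_process {d} {T : measurableType d}
    (S : R -> T -> nat -> \bar R) : Prop :=
  (forall (t : R) (k : nat), 0 <= t ->
    measurable_fun [set: T] (fun w => S t w k : \bar R)) /\
  (forall w, cadlag_in Pspace (fun t : R => S t w : {ptws nat -> \bar R})).

(* (T', P', pi) is the enlargement of (T, P), on which S is read as S \o pi.
   The copies are indexed as C k t w. *)
Definition branching_property {d} {T : measurableType d} (P : probability T R)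
    (S : R -> T -> nat -> \bar R) : Prop :=
  forall r : R, 0 < r ->
  exists (d' : measure_display) (T' : measurableType d')
    (P' : probability T' R) (pi : T' -> T) (C : nat -> R -> T' -> nat -> \bar R),
  [/\ measurable_fun [set: T'] pi /\
        (forall A, measurable A -> P' (pi @^-1` A) = P A),
      forall k, Pspace_cadlag_process (C k) /\
        same_law [set i | 0 <= i.1] P' (coordinates (C k)) P (coordinates S),
      mutually_independent P'
        (fun k => sigma_of [set i | 0 <= i.1] (coordinates (C k))),
      independent P'
        (sigma_of [set i | 0 <= i.2.1]
           (fun i : nat * (R * nat) => coordinates (C i.1) i.2))
        (sigma_of [set i | 0 <= i.1 <= r]
           (coordinates (fun (t : R) w => S t (pi w)))) &
      {ae P', forall w, forall t : R, 0 <= t ->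
        is_superposition (S (t + r) (pi w))
          (fun k => translate (S r (pi w) k) (C k t w))} ].

(* [e] is the signed scaling exponent, epsilon * alpha. *)
Record branching_stable {d} {T : measurableType d} (P : probability T R)
    (e : R) (S : R -> T -> nat -> \bar R) : Prop := BranchingStable {
  bs_process : Pspace_cadlag_process S ;
  bs_start : forall w, S 0 w = single_atom 0 ;
  bs_exp_moment : exists2 theta : R, 0 <= theta &
    (\int[P]_w \int[point_measure (S 1%R w)]_x (expR (- (theta * x))%R)%:E
       < +oo)%E ;
  bs_branching : branching_property P S ;
  bs_selfsimilar : forall c : R, 0 < c ->
    same_law [set i | 0 <= i.1]
      P (coordinates (fun t : R => S (c `^ e * t)))
      P (coordinates (fun (t : R) w => dilate c (S t w))) }.

Definition degenerate {d} {T : measurableType d} (P : probability T R)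
    (X : T -> nat -> \bar R) : Prop :=
  {ae P, forall w, forall k, X w k != +oo%E -> X w k = 0%E}.

End branching_stable_processes.

Section stable_levy_processes.
Context {R : realType}.

Record levy_process {d} {T : measurableType d} (P : probability T R)
    (xi : R -> T -> R) : Prop := LevyProcess {
  levy_measurable : forall t : R, 0 <= t -> measurable_fun [set: T] (xi t) ;
  levy_cadlag : forall w, cadlag_in [set: R] (xi ^~ w) ;
  levy_start : forall w, xi 0 w = 0 ;
  levy_indep_incr : forall s t : R, 0 <= s -> 0 <= t ->
    independent P (sigma_of [set u | 0 <= u <= t] xi)
      (sigma_of [set: unit] (fun _ w => xi (t + s) w - xi t w)) ;
  levy_stat_incr : forall s t : R, 0 <= s -> 0 <= t ->
    forall A, measurable A ->
      P [set w | A (xi (t + s) w - xi t w)] = P [set w | A (xi s w)] }.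

Definition stable_levy_process {d} {T : measurableType d} (P : probability T R)
    (alpha : R) (xi : R -> T -> R) : Prop :=
  [/\ levy_process P xi,
      ~ {ae P, forall w, forall t : R, 0 <= t -> xi t w = 0} &
      forall c : R, 0 < c ->
        same_law [set t | 0 <= t]
          P (fun t : R => xi (c `^ alpha * t)) P (fun (t : R) w => c * xi t w)].

End stable_levy_processes.

(* Main.v *)
(** Scaling by powers of 2 makes the probability that the leftmost atom is
    unbounded above on the rationals of [0, T] independent of T, and right
    continuity at 0 makes it vanish; so the leftmost atom never reaches +oo.
    The mass M(t) = E[\int e^(-theta x) S_t(dx)] is multiplicative in t by
    branching, so M(2^-n) -> 1; since S_(2^-n) has the law of 2^(-n/alpha) S_1,
    Fatou gives E[S_1(R)] <= 1, hence S_t is a single atom xi_t, and the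
    branching property turns into stationary independent increments.
    If alpha > 2, let g(t) be the modulus of E[e^(i l xi_t)]. It is
    multiplicative in t, and 1 - cos(2v) <= 4 (1 - cos v) together with scaling
    gives 1 - g(2^alpha t) <= 4 (1 - g(t)), while multiplicativity makes 1 - g
    asymptotically linear at 0; as 2^alpha > 4 this forces g = 1, so xi_1 is
    constant, and the constant is 0 by scaling. *)

Require Import Defs.
From HB Require Import structures.
From mathcomp Require Import all_boot all_order all_algebra.
From mathcomp Require Import all_classical all_reals all_analysis.
From mathcomp Require Import measurable_realfun.
From mathcomp Require Import lra ring.

Import Order.TTheory GRing.Theory Num.Theory.
Import numFieldNormedType.Exports.

Local Open Scope classical_set_scope.
Local Open Scope ring_scope.

(** * Laws, independence and events of full probability *)

Section laws.
Context {R : realType}.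

(** [Pspace] contains the empty configuration, so a mean number of atoms at most 1 still allows a
    random choice between none and several; only almost sure survival turns the bound into exactly
    one atom. The number of atoms is not assumed integrable, which is why an exponential weight is
    carried along: self-similarity trades the time [2^-n] for the parameter [theta * 2^(-n/alpha)]
    at time 1, and this tends to 0, where the weight counts atoms. Laws give statements at fixed
    times; one null set for all times comes from rational times, right continuity and the openness
    of sets such as [x < +oo]. Left limits need the same care, since the paths of [xi] must have
    them in the reals. The modulus of the characteristic function is used because, unlike its real
    part, it is multiplicative under independence, and because dividing out the phase centres the
    variable, so that the quadratic bound on the cosine applies. The factor 4 is [2^2], which is the
    origin of the threshold 2. The modulus cannot see a deterministic drift, hence the last scaling
    argument. *)

Lemma probability_ae1 {d} {T : measurableType d} (P : probability T R)
    (A : set T) :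
  measurable A -> {ae P, forall w, A w} -> P A = 1%E.
Proof.
move=> mA aeA; rewrite -[A]setCK probability_setC; last exact: measurableC.
by rewrite (measure_negligible (measurableC mA))// sube0.
Qed.

Lemma probability_ae_exists {d} {T : measurableType d} (P : probability T R)
    (Q : T -> Prop) : {ae P, forall w, Q w} -> exists w, Q w.
Proof.
move=> [N [mN N0 HN]]; apply: contrapT => /forallNP Hn.
have NT : N = setT by apply/seteqP; split => // w _; apply: HN; exact: Hn.
have := @probability_setT _ _ _ P.
by rewrite -NT N0 => /esym/eqP; rewrite onee_eq0.
Qed.

(** The sets whose preimage lies in [M] form a sigma-algebra. Both [M] and [h] are arbitrary, so
    that one statement covers measurability, path events ([path_sigma] is by conversion the
    [sigma_of] of the evaluations) and transfer to an enlarged space. *)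
Lemma sigma_of_preimage {T T' I : Type} {dE} {E : measurableType dE}
    (D : set I) (X : I -> T' -> E) (h : T -> T') (M : set (set T)) :
  sigma_algebra setT M ->
  (forall i A, D i -> measurable A -> M (h @^-1` (X i @^-1` A))) ->
  forall B, sigma_of D X B -> M (h @^-1` B).
Proof.
move=> [M0 MC MU] MX; apply: smallest_sub; last first.
  by move=> _ [i [A [Di mA ->]]]; exact: MX.
split=> [|A MA|F MF]; first by rewrite preimage_set0.
- by rewrite setTD preimage_setC -setTD; exact: MC.
- by rewrite preimage_bigcup; exact: MU.
Qed.

Lemma sigma_of_measurable {d} {T : measurableType d} {I : Type} {dE}
    {E : measurableType dE} {D : set I} {X : I -> T -> E} :
  (forall i, D i -> measurable_fun setT (X i)) ->
  forall B, sigma_of D X B -> measurable B.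
Proof.
move=> mX; apply: (@sigma_of_preimage _ _ _ _ _ _ _ id) => //.
  exact: sigma_algebra_measurable.
by move=> i A Di mA; rewrite -[X in measurable X]setTI; exact: mX.
Qed.

Lemma measurable_path_event {d} {T : measurableType d} {I : Type} {dE}
    {E : measurableType dE} {D : set I} {X : I -> T -> E} :
  (forall i, D i -> measurable_fun setT (X i)) ->
  forall B, path_sigma D B -> measurable [set w | B (X ^~ w)].
Proof.
move=> mX B; apply: (@sigma_of_preimage _ _ _ _ _ _ _ (fun w => X ^~ w)) => //.
  exact: sigma_algebra_measurable.
by move=> i A Di mA; rewrite -[X in measurable X]setTI; exact: mX.
Qed.

Lemma sigma_of_gen {T I : Type} {dE} {E : measurableType dE} (D : set I)
    (X : I -> T -> E) i A : D i -> measurable A -> sigma_of D X (X i @^-1` A).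
Proof. by move=> Di mA; apply: sub_sigma_algebra; exists i, A. Qed.

Lemma same_law_marginal {I : Type} {dE} {E : measurableType dE} (D : set I)
    {d1} {T1 : measurableType d1} (P1 : probability T1 R) (X : I -> T1 -> E)
    {d2} {T2 : measurableType d2} (P2 : probability T2 R) (Y : I -> T2 -> E) i A :
  same_law D P1 X P2 Y -> D i -> measurable A ->
  P1 (X i @^-1` A) = P2 (Y i @^-1` A).
Proof.
move=> XY Di mA; apply: (XY [set p | A (p i)]).
by apply: sub_sigma_algebra; exists i, A.
Qed.

Lemma ge0_integral_same_marginal {dE} {E : measurableType dE}
    {d1} {T1 : measurableType d1} (P1 : probability T1 R) (X : T1 -> E)
    {d2} {T2 : measurableType d2} (P2 : probability T2 R) (Y : T2 -> E)
    (f : E -> \bar R) :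
  measurable_fun setT X -> measurable_fun setT Y -> measurable_fun setT f ->
  (forall x, (0 <= f x)%E) ->
  (forall A, measurable A -> P1 (X @^-1` A) = P2 (Y @^-1` A)) ->
  (\int[P1]_w f (X w) = \int[P2]_w f (Y w))%E.
Proof.
move=> mX mY mf f0 XY.
pose X' : {mfun T1 >-> E} := mfun_Sub (mem_set mX).
pose Y' : {mfun T2 >-> E} := mfun_Sub (mem_set mY).
have := @ge0_integral_distribution _ _ _ _ _ P1 X' f mf f0.
have := @ge0_integral_distribution _ _ _ _ _ P2 Y' f mf f0.
rewrite /comp /= => <- <-; apply: eq_measure_integral => A mA _.
exact: XY.
Qed.

(** Independence says that the joint law agrees with the product law on rectangles; uniqueness of
    product measures and Tonelli conclude. *)
Lemma ge0_integral_mul_indep {d} {T : measurableType d} (P : probability T R)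
    (X Y : T -> \bar R) :
  measurable_fun setT X -> measurable_fun setT Y ->
  (forall w, (0 <= X w)%E) -> (forall w, (0 <= Y w)%E) ->
  (forall A B, measurable A -> measurable B ->
    P (X @^-1` A `&` Y @^-1` B) = P (X @^-1` A) * P (Y @^-1` B))%E ->
  (\int[P]_w (X w * Y w) = (\int[P]_w X w) * \int[P]_w Y w)%E.
Proof.
move=> mX mY X0 Y0 XY.
pose X' : {mfun T >-> \bar R} := mfun_Sub (mem_set mX).
pose Y' : {mfun T >-> \bar R} := mfun_Sub (mem_set mY).
have mXY : measurable_fun setT (fun w => (X w, Y w)) by exact: measurable_fun_pair.
pose Z' : {mfun T >-> (\bar R * \bar R)%type} := mfun_Sub (mem_set mXY).
(* Tonelli asks for nonnegativity on the whole plane; the absolute values provide it and change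
   nothing on the range of [(X, Y)]. *)
pose f (z : (\bar R * \bar R)%type) := (`|z.1| * `|z.2|)%E.
have mf : measurable_fun setT f.
  by apply: emeasurable_funM; apply: measurableT_comp => //;
    (exact: measurable_fst || exact: measurable_snd).
have f0 z : (0 <= f z)%E by exact: mule_ge0.
have m1 : measurable_fun setT (fun x : \bar R => `|x|%E) by exact: abse_measurable.
transitivity (\int[P]_w (f \o Z') w)%E.
  by apply: eq_integral => w _; rewrite /f/= !gee0_abs.
rewrite -(ge0_integral_distribution Z' mf f0).
rewrite (eq_measure_integral (distribution P X' \x distribution P Y')%E); last first.
  move=> A mA _; apply/esym; apply: product_measure_unique mA => U V mU mV.
  exact: XY.
rewrite (fubini_tonelli1 f mf f0) /fubini_F /f /=.
under eq_integral do rewrite ge0_integralZl//.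
rewrite ge0_integralZr//; last exact: integral_ge0.
rewrite (ge0_integral_distribution X')// (ge0_integral_distribution Y')//.
by congr (_ * _)%E; apply: eq_integral => w _; rewrite /= gee0_abs.
Qed.

End laws.

(** * Exponential weights, integrals against point measures, superpositions *)

Section point_measures.
Context {R : realType}.

(* The convention [e^(-theta * oo) = 0] is imposed also for [theta = 0], so that
   [exp_weight 0] counts the atoms at finite positions. *)
Definition exp_weight (theta : R) (x : \bar R) : \bar R :=
  if x is r%:E then (expR (- (theta * r)))%:E else 0%E.

Lemma exp_weight_ge0 theta x : (0 <= exp_weight theta x)%E.
Proof. by case: x => [r| |] //=; rewrite lee_fin expR_ge0. Qed.

Lemma measurable_exp_weight theta : measurable_fun setT (exp_weight theta).
Proof.
have -> : exp_weight theta =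
    (fun x => if (x < +oo)%E then if (-oo < x)%E then
      (expR (- (theta * fine x)))%:E else 0%E else 0%E).
  by apply/funext => -[r| |]/=; rewrite ?ltry ?ltNyr ?ltxx.
apply: measurable_fun_ifT => //; first exact: measurable_fun_lte.
apply: measurable_fun_ifT => //; first exact: measurable_fun_lte.
apply/measurable_EFinP; apply: measurableT_comp => //.
apply: measurableT_comp => //; apply: measurable_funM => //.
Qed.

Lemma exp_weightD theta (x y : \bar R) : y != -oo%E ->
  exp_weight theta (x + y) = (exp_weight theta x * exp_weight theta y)%E.
Proof.
case: x => [r| |]; case: y => [s| |] //= _; rewrite ?mule0 ?mul0e //.
by rewrite -EFinM -expRD; congr (expR _)%:E; ring.
Qed.

Lemma exp_weight_scale theta c x : 0 < c ->
  exp_weight theta (c%:E * x) = exp_weight (theta * c) x.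
Proof.
move=> c0; case: x => [r| |] /=.
- by rewrite mulrA.
- by rewrite gt0_muley ?lte_fin.
- by rewrite gt0_muleNy ?lte_fin.
Qed.

Lemma integral_point_measure (x : nat -> \bar R) (g : R -> \bar R) :
  measurable_fun setT g -> (forall r, (0 <= g r)%E) ->
  (\int[point_measure x]_r g r =
   \sum_(k <oo) if x k is r%:E then g r else 0)%E.
Proof.
move=> mg g0; rewrite ge0_integral_measure_series//.
apply: eq_eseriesr => k _; case: (x k) => [r| |].
- by rewrite integral_dirac// diracT mul1e.
- exact: integral_measure_zero.
- exact: integral_measure_zero.
Qed.

Lemma integral_superposition (z : nat -> \bar R) (x : nat -> nat -> \bar R)
    (g : R -> \bar R) :
  measurable_fun setT g -> (forall r, (0 <= g r)%E) -> is_superposition z x ->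
  (\int[point_measure z]_r g r =
   \sum_(k <oo) \int[point_measure (x k)]_r g r)%E.
Proof.
move=> mg g0 zx; rewrite -ge0_integral_measure_series//.
by apply: eq_measure_integral => A mA _; exact: zx.
Qed.

Lemma integral_exp_weight theta (x : nat -> \bar R) :
  (\int[point_measure x]_r (expR (- (theta * r)))%:E =
   \sum_(k <oo) exp_weight theta (x k))%E.
Proof.
rewrite integral_point_measure//.
by apply/measurable_EFinP; apply: measurableT_comp => //; apply: measurableT_comp.
Qed.

Lemma exp_weight_superposition theta (z y : nat -> \bar R)
    (x : nat -> nat -> \bar R) :
  (forall k j, x k j != -oo%E) ->
  is_superposition z (fun k => translate (y k) (x k)) ->
  (\sum_(k <oo) exp_weight theta (z k) =
   \sum_(k <oo) \sum_(j <oo) (exp_weight theta (y k) * exp_weight theta (x k j)))%E.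
Proof.
move=> xNy zx; rewrite -integral_exp_weight (integral_superposition _ _ _ _ _ zx)//.
- apply: eq_eseriesr => k _; rewrite integral_exp_weight.
  by apply: eq_eseriesr => j _; rewrite exp_weightD.
- by apply/measurable_EFinP; apply: measurableT_comp => //; apply: measurableT_comp.
Qed.

Lemma point_measure_single_atom (r : R) A :
  point_measure (single_atom r) A = \d_r A.
Proof.
rewrite /point_measure /= /mseries/= (nneseries_recl _) //= eseries0 ?adde0//.
by case.
Qed.

(** Both measures are evaluated at the singleton of [z0]. Parents of index at least 1 sit at [+oo],
    so their translated families are empty measures, and the value 1 on the left forces the only
    remaining atom to be at [z0]. *)
Lemma superposition_single_atom (z0 y0 c0 : R) (x : nat -> nat -> \bar R) :
  (forall k j, x k j != -oo%E) -> x 0%N = single_atom c0 ->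
  is_superposition (single_atom z0) (fun k => translate (single_atom y0 k) (x k)) ->
  z0 = y0 + c0.
Proof.
move=> xNy x0 /(_ [set z0] (measurable_set1 z0)).
rewrite point_measure_single_atom diracE mem_set// nneseries_recl//=.
have -> : translate y0%:E (x 0%N) = single_atom (y0 + c0).
  by rewrite x0; apply/funext => -[|k].
rewrite point_measure_single_atom eseries0 ?adde0; last first.
  move=> [//|k] _ _ /=.
  rewrite /point_measure /mseries/= eseries0// => j _ _.
  by rewrite /translate/= addye.
rewrite diracE; have [/set_mem/= ->//|_ [/eqP]] := boolP (y0 + c0 \in [set z0]).
by rewrite oner_eq0.
Qed.

End point_measures.

(** * Finiteness of the leftmost atom along paths *)

Section explosion.
Context {R : realType}.

Lemma ptws_cvg_coord {T : Type} (F : set_system T)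
    (f : T -> {ptws nat -> \bar R}) (l : {ptws nat -> \bar R}) k :
  f @ F --> l -> (fun s => f s k) @ F --> l k.
Proof.
move=> fl; have pc : {for l, continuous (fun x : {ptws nat -> \bar R} => x k)}.
  exact: (@proj_continuous nat (fun _ => \bar R) k l).
exact: (cvg_comp _ _ fl pc).
Qed.

(** Rational times keep this event in the path sigma-algebra, and quantifying over every [K] makes
    it invariant under multiplication of the path by a positive constant, so that self-similarity
    acts on it through time alone. *)
Definition unbounded_paths : set (R * nat -> \bar R) :=
  [set p | forall K : nat, exists q : rat,
     0 <= (ratr q : R) <= 1 /\ (K%:R%:E < p (ratr q, 0%N))%E].

Lemma path_sigma_unbounded : path_sigma [set i | 0 <= i.1] unbounded_paths.
Proof.
have -> : unbounded_paths = \bigcap_(K : nat) \bigcup_(q : rat)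
   [set p | 0 <= (ratr q : R) <= 1 /\ (K%:R%:E < p (ratr q, 0%N))%E].
  apply/seteqP; split => p /= H K; last by have [q _ ?] := H K I; exists q.
  by move=> _; have [q ?] := H K; exists q.
pose G := [set B | exists (i : R * nat) A, [/\ 0 <= i.1, measurable A
  & B = [set p : R * nat -> \bar R | A (p i)]] ].
apply: (@bigcap_measurableType _ (g_sigma_algebraType G)) => K _.
apply: (@bigcupT_measurable_rat _ (g_sigma_algebraType G)) => q.
have [/andP[q0 q1]|q01] := boolP (0 <= (ratr q : R) <= 1); last first.
  rewrite [X in measurable X](_ : _ = set0)//.
  by apply/seteqP; split => p [].
apply: sub_sigma_algebra; exists (ratr q, 0%N), [set x | (K%:R%:E < x)%E].
split => //; last by apply/seteqP; split => p //= -[].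
by rewrite -set_itvoy; exact: emeasurable_itv.
Qed.

Context {d} {T : measurableType d} {P : probability T R} {alpha : R}
  {S : R -> T -> nat -> \bar R}.
Hypothesis alpha0 : 0 < alpha.
Hypothesis bsS : branching_stable P alpha S.

Lemma coordinate_measurable (i : R * nat) : 0 <= i.1 ->
  measurable_fun setT (coordinates S i).
Proof. by move=> i0; have [mS _] := bs_process bsS; exact: mS. Qed.

Lemma self_similar_pow (b : R) (B : set (R * nat -> \bar R)) : 0 < b ->
  path_sigma [set i | 0 <= i.1] B ->
  P [set w | B (fun i => S (b * i.1) w i.2)] =
  P [set w | B (fun i => ((b `^ alpha^-1)%:E * S i.1 w i.2)%E)].
Proof.
move=> b0 BB; have c0 : 0 < b `^ alpha^-1 by rewrite powR_gt0.
have := bs_selfsimilar bsS c0 BB.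
by rewrite -powRrM mulVf ?gt_eqF// powRr1// ltW.
Qed.

Lemma self_similar_unbounded (b : R) : 0 < b ->
  P [set w | unbounded_paths (fun i => S (b * i.1) w i.2)] =
  P [set w | unbounded_paths (coordinates S ^~ w)].
Proof.
move=> b0; rewrite self_similar_pow//; last exact: path_sigma_unbounded.
have c0 : 0 < b `^ alpha^-1 by rewrite powR_gt0.
move: (b `^ _) c0 => c c0.
congr (P _); apply/seteqP; split => w /= H K.
- have [M KM] : exists M : nat, c * K%:R <= M%:R.
    exists (Num.bound (c * K%:R)); rewrite ltW// archi_boundP//.
    by rewrite mulr_ge0// ltW.
  have [q [q01 Mq]] := H M; exists q; split => //.
  by rewrite -(@lte_pmul2l _ c%:E)// (le_lt_trans _ Mq)//.
- have [M KM] : exists M : nat, c^-1 * K%:R <= M%:R.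
    exists (Num.bound (c^-1 * K%:R)); rewrite ltW// archi_boundP//.
    by rewrite mulr_ge0// invr_ge0 ltW.
  have [q [q01 Mq]] := H M; exists q; split => //.
  by rewrite -lte_pdivrMl// (le_lt_trans _ Mq)// -EFinM lee_fin.
Qed.

Lemma bounded_near0 w : exists2 e : R, 0 < e &
  forall t, 0 <= t < e -> (S t w 0%N < 1)%E.
Proof.
have [_ /(_ w) [_ /(_ 0 (lexx _)) rc _]] := bs_process bsS.
have /= := ptws_cvg_coord _ _ _ 0%N rc.
rewrite (bs_start bsS) => /(_ [set x | (x < 1)%E]) /= -[|e /= e0 He].
  by apply: open_ereal_lt'; rewrite /= lte01.
exists e => // t /andP[t0 te].
have [->|tn0] := eqVneq t 0; first by rewrite (bs_start bsS) /= lte01.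
have t1 : 0 < t by rewrite lt_neqAle eq_sym tn0.
by apply: He => //=; rewrite sub0r normrN gtr0_norm.
Qed.

Lemma pow2_small (e : R) : 0 < e -> exists n : nat, 2^-1 ^+ n < e.
Proof.
move=> e0; exists (Num.bound e^-1).
rewrite exprVn -[X in _ < X]invrK ltf_pV2 ?posrE ?invr_gt0 ?exprn_gt0//.
have := archi_boundP (x := e^-1); rewrite invr_ge0 (ltW e0) => /(_ isT).
move=> /lt_le_trans; apply.
by rewrite -natrX ler_nat ltnW// ltn_expl.
Qed.

Lemma unbounded_null : P [set w | unbounded_paths (coordinates S ^~ w)] = 0%E.
Proof.
pose F n := [set w | unbounded_paths (fun i => S (2^-1 ^+ n * i.1) w i.2)].
have p2 n : 0 < 2^-1 ^+ n :> R by rewrite exprn_gt0.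
have mF n : measurable (F n).
  apply: (@measurable_path_event _ _ _ _ _ [set i | 0 <= i.1]
    (fun i w => S (2^-1 ^+ n * i.1) w i.2)); last exact: path_sigma_unbounded.
  move=> i i0; apply: (coordinate_measurable (2^-1 ^+ n * i.1, i.2)) => /=.
  by rewrite mulr_ge0// ltW.
have F0 : \bigcap_n F n = set0.
  apply/seteqP; split => // w Fw.
  have [e e0 He] := bounded_near0 w.
  have [n ne] := pow2_small e e0.
  have [q [/andP[q0 q1]]] := Fw n I 1%N.
  rewrite ltNge => /negP; apply; rewrite /= ltW// He//.
  rewrite mulr_ge0//= ?(ltW (p2 n))//.
  by rewrite (le_lt_trans _ ne)// ler_piMr// ltW.
have : (P \o F) n @[n --> \oo] --> P (\bigcap_n F n).
  apply: nonincreasing_cvg_mu => //.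
  - by rewrite (le_lt_trans (probability_le1 _ _))// ltry.
  - by rewrite F0.
  - apply/nonincreasing_seqP => n; apply/subsetPset => w Fw K.
    (* Time [q] at scale [n.+1] is time [q / 2] at scale [n]. *)
    have [q [/andP[q0 q1] Kq]] := Fw K; exists (q / 2).
    rewrite fmorph_div /= ratr_nat; split; first by apply/andP; split; lra.
    by move: Kq; rewrite /= exprSr; congr (_ < S _ w _)%E; field.
rewrite F0 measure0 (_ : P \o F = cst (P [set w | unbounded_paths (coordinates S ^~ w)])).
  by move=> /cvg_lim <-//; rewrite lim_cst.
by apply/funext => n /=; rewrite self_similar_unbounded.
Qed.

Lemma no_explosion : {ae P, forall w, forall n : nat, exists K : nat,
  forall q : rat, 0 <= (ratr q : R) <= 1 ->
    (S (2 ^+ n * ratr q) w 0%N <= K%:R%:E)%E}.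
Proof.
apply: ae_foralln => n.
have p2 : 0 < 2 ^+ n :> R by rewrite exprn_gt0.
exists [set w | unbounded_paths (fun i => S (2 ^+ n * i.1) w i.2)]; split.
- apply: (@measurable_path_event _ _ _ _ _ [set i | 0 <= i.1]
    (fun i w => S (2 ^+ n * i.1) w i.2)); last exact: path_sigma_unbounded.
  move=> i i0; apply: (coordinate_measurable (2 ^+ n * i.1, i.2)) => /=.
  by rewrite mulr_ge0// ltW.
- exact: (etrans (self_similar_unbounded _ p2) unbounded_null).
- move=> w /= /forallNP H K; have /existsNP[q /not_implyP[q01 Hq]] := H K.
  by exists q; split => //; rewrite ltNge; exact/negP.
Qed.

(** The set [x > K] is open, so an excess over [K] at a time, or in a left limit, persists on a
    one-sided neighbourhood, which contains some [2 ^+ n * ratr q]. The part on left limits is what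
    later makes the left limits of the real-valued process finite. *)
Lemma bounded_cadlag (f : R -> {ptws nat -> \bar R}) :
  cadlag_in Pspace f ->
  (forall n : nat, exists K : nat, forall q : rat, 0 <= (ratr q : R) <= 1 ->
    (f (2 ^+ n * ratr q)%R 0%N <= K%:R%:E)%E) ->
  (forall t, 0 <= t -> (f t 0%N < +oo)%E) /\
  (forall t (l : {ptws nat -> \bar R}), 0 < t -> f @ t^'- --> l -> (l 0%N < +oo)%E).
Proof.
move=> [fP frc _] fK.
have dense n (K : nat) (x y : R) :
    (forall q : rat, 0 <= (ratr q : R) <= 1 -> (f (2 ^+ n * ratr q)%R 0%N <= K%:R%:E)%E) ->
    0 <= x -> x < y -> y <= 2 ^+ n -> exists2 s, x < s < y & (f s 0%N <= K%:R%:E)%E.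
  move=> HK x0 xy yn; have p2 : 0 < 2 ^+ n :> R by rewrite exprn_gt0.
  have /rat_in_itvoo[q] : x / 2 ^+ n < y / 2 ^+ n by rewrite ltr_pM2r ?invr_gt0.
  rewrite in_itv/= ltr_pdivrMr// ltr_pdivlMr// mulrC => /andP[xq qy].
  exists (2 ^+ n * ratr q); first by rewrite xq qy.
  apply: HK; rewrite -(@ler_pM2l _ (2 ^+ n))// mulr0 (le_trans x0 (ltW xq))/=.
  by rewrite -(@ler_pM2l _ (2 ^+ n))// mulr1 (le_trans (ltW qy)).
have big (t : R) : exists n : nat, t < 2 ^+ n.
  have [t0|t0] := ltP t 0; first by exists 0%N; rewrite expr0 (lt_trans t0).
  exists (Num.bound t); rewrite (lt_trans (archi_boundP t0))//.
  by rewrite -natrX ltr_nat ltn_expl.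
have bd (n K : nat) : (forall q : rat, 0 <= (ratr q : R) <= 1 ->
    (f (2 ^+ n * ratr q)%R 0%N <= K%:R%:E)%E) ->
    forall t, 0 <= t < 2 ^+ n -> (f t 0%N <= K%:R%:E)%E.
  move=> HK t /andP[t0 tn]; rewrite leNgt; apply/negP => Kf.
  have := ptws_cvg_coord _ _ _ 0%N (frc t t0).
  move=> /(_ [set x | (K%:R%:E < x)%E]) /= -[|e /= e0 He].
    exact: open_ereal_gt'.
  have [||s /andP[ts st]] := @dense n K t (Num.min (2 ^+ n) (t + e)) HK t0.
  - by rewrite lt_min tn ltrDl.
  - by rewrite ge_min lexx.
  - move: st; rewrite lt_min => /andP[sn se].
    rewrite leNgt => /negP; apply; apply: He => //=.
    by rewrite distrC gtr0_norm ?subr_gt0// ltrBlDl.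
split=> [t t0|t l t0 fl]; have [n tn] := big t; have [K HK] := fK n.
  by rewrite (le_lt_trans (bd _ _ HK t _))// ?t0//= ltry.
rewrite ltNge; apply/negP => lK.
have := ptws_cvg_coord _ _ _ 0%N fl.
move=> /(_ [set x | (K%:R%:E < x)%E]) /= -[|e /= e0 He].
  by apply: open_ereal_gt'; rewrite (lt_le_trans _ lK)// ltry.
have [||s /andP[ts st]] := @dense n K (Num.max 0 (t - e)) t HK _ _ (ltW tn).
- by rewrite le_max lexx.
- by rewrite gt_max t0 ltrBlDr ltrDl.
- move: ts; rewrite gt_max => /andP[s0 se].
  rewrite leNgt => /negP; apply; apply: He => //=.
  by rewrite gtr0_norm ?subr_gt0// ltrBlDl addrC -ltrBlDl.
Qed.

End explosion.

(** * Exponential mass and absence of a second atom *)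

Section mass.
Context {R : realType}.

Lemma nneseriesZr_ge0 (a : nat -> \bar R) (c : \bar R) :
  (forall k, (0 <= a k)%E) -> (0 <= c)%E ->
  (\sum_(k <oo) (a k * c) = (\sum_(k <oo) a k) * c)%E.
Proof.
move=> a0 c0; rewrite -(ge0_integral_count (fun k => mule_ge0 (a0 k) c0)).
by rewrite ge0_integralZr// ge0_integral_count.
Qed.

Context {d} {T : measurableType d} {P : probability T R} {alpha : R}
  {S : R -> T -> nat -> \bar R}.
Hypothesis alpha0 : 0 < alpha.
Hypothesis bsS : branching_stable P alpha S.

(** By Tonelli this is the expectation of the integral of [e^(-theta x)] against [S t]. Written
    coordinate by coordinate, it depends only on the laws of single coordinates. *)
Definition mass (theta t : R) : \bar R :=
  (\sum_(k <oo) \int[P]_w exp_weight theta (S t w k))%E.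

Lemma mass_ge0 theta t : (0 <= mass theta t)%E.
Proof.
apply: nneseries_ge0 => k _ _; apply: integral_ge0 => w _.
exact: exp_weight_ge0.
Qed.

Lemma Pspace_process_measurable {d'} {T' : measurableType d'}
    (C : R -> T' -> nat -> \bar R) t k : Pspace_cadlag_process C -> 0 <= t ->
  measurable_fun setT (fun w => C t w k).
Proof. by move=> [mC _] t0; exact: mC. Qed.

Lemma process_neqNy {d'} {T' : measurableType d'}
    (C : R -> T' -> nat -> \bar R) t w k : Pspace_cadlag_process C -> 0 <= t ->
  C t w k != -oo%E.
Proof. by move=> [_ /(_ w) [/(_ t) H _ _]] t0; have [] := H t0. Qed.

Lemma process_homo {d'} {T' : measurableType d'}
    (C : R -> T' -> nat -> \bar R) t w k l : Pspace_cadlag_process C -> 0 <= t ->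
  (k <= l)%N -> (C t w k <= C t w l)%E.
Proof. by move=> [_ /(_ w) [/(_ t) H _ _]] t0; have [_ + _] := H t0; exact. Qed.

(** The weight turns translation by the parent into a factor, and copy [k] is independent of the
    position of parent [k], so every term of the double sum splits. All terms are nonnegative, hence
    the identity holds in [[0, +oo]]. *)
Lemma massD theta r t : 0 < r -> 0 <= t ->
  (mass theta (t + r) = mass theta r * mass theta t)%E.
Proof.
move=> r0 t0; have rt0 : 0 <= t + r by rewrite addr_ge0// ltW.
have [d' [T' [P' [pi [C [[mpi piP] HC _ indep super]]]]]] := bs_branching bsS r0.
have pS := bs_process bsS.
have mf := measurable_exp_weight theta.
have f0 := exp_weight_ge0 theta.
have mS k s : 0 <= s -> measurable_fun setT (fun w => S s w k).
  exact: Pspace_process_measurable.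
have mfS k s : 0 <= s -> measurable_fun setT (fun w => exp_weight theta (S s w k)).
  by move=> s0; apply: (measurableT_comp mf); exact: mS.
have mSpi k s : 0 <= s -> measurable_fun setT (fun w => S s (pi w) k).
  by move=> s0; apply: (measurableT_comp (mS k s s0)).
have mC k j : measurable_fun setT (fun w => C k t w j).
  by apply: Pspace_process_measurable t0; have [] := HC k.
transitivity (\int[P]_w \sum_(k <oo) exp_weight theta (S (t + r) w k))%E.
  by rewrite integral_nneseries// => k; exact: mfS.
transitivity (\int[P']_w \sum_(k <oo) exp_weight theta (S (t + r) (pi w) k))%E.
  apply: (ge0_integral_same_marginal P idfun P' pi
    (fun w => \sum_(k <oo) exp_weight theta (S (t + r) w k))%E) => //.
  - exact: measurable_id.
  - by apply: ge0_emeasurable_sum => // k _; exact: mfS.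
  - by move=> w; exact: nneseries_ge0.
  - by move=> A mA; rewrite piP.
have mfSpi k s : 0 <= s -> measurable_fun setT (fun w => exp_weight theta (S s (pi w) k)).
  by move=> s0; apply: (measurableT_comp mf); exact: mSpi.
have mfC k j : measurable_fun setT (fun w => exp_weight theta (C k t w j)).
  exact: (measurableT_comp mf).
have mprod k j : measurable_fun setT
    (fun w => exp_weight theta (S r (pi w) k) * exp_weight theta (C k t w j))%E.
  by apply: emeasurable_funM => //; apply: mfSpi; exact: ltW.
have prod0 k j w :
    (0 <= exp_weight theta (S r (pi w) k) * exp_weight theta (C k t w j))%E.
  exact: mule_ge0.
transitivity (\int[P']_w \sum_(k <oo) \sum_(j <oo)
    (exp_weight theta (S r (pi w) k) * exp_weight theta (C k t w j)))%E.
  apply: ge0_ae_eq_integral => //.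
  - by apply: ge0_emeasurable_sum => // k _; exact: mfSpi.
  - apply: ge0_emeasurable_sum => // [k w _ _|k _]; first exact: nneseries_ge0.
    exact: ge0_emeasurable_sum.
  - by move=> w _; exact: nneseries_ge0.
  - by move=> w _; apply: nneseries_ge0 => k _ _; exact: nneseries_ge0.
  - apply: filterS super => w /(_ t t0) super _.
    apply: exp_weight_superposition super => k j.
    by apply: process_neqNy t0; have [] := HC k.
rewrite integral_nneseries//; last 2 first.
  by move=> k; exact: ge0_emeasurable_sum.
  by move=> k w _; exact: nneseries_ge0.
rewrite /mass -nneseriesZr_ge0; last 2 first.
  by move=> k; exact: integral_ge0.
  exact: mass_ge0.
apply: eq_eseriesr => k _; rewrite integral_nneseries//.
rewrite muleC -nneseriesZr_ge0; last 2 first.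
  by move=> j; exact: integral_ge0.
  exact: integral_ge0.
apply: eq_eseriesr => j _; rewrite ge0_integral_mul_indep//; last 2 first.
  by apply: mfSpi; exact: ltW.
  move=> A B mA mB; rewrite setIC muleC; apply: indep.
    have -> : (fun w => exp_weight theta (C k t w j)) @^-1` B =
      (fun i : nat * (R * nat) => coordinates (C i.1) i.2) (k, (t, j)) @^-1`
      (exp_weight theta @^-1` B) by [].
    apply: sigma_of_gen => //; rewrite -[X in measurable X]setTI; exact: mf.
  have -> : (fun w => exp_weight theta (S r (pi w) k)) @^-1` A =
      coordinates (fun (t : R) w => S t (pi w)) (r, k) @^-1`
      (exp_weight theta @^-1` A) by [].
  apply: sigma_of_gen => /=; first by rewrite (ltW r0) lexx.
  by rewrite -[X in measurable X]setTI; exact: mf.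
rewrite muleC; congr (_ * _)%E.
  apply: (ge0_integral_same_marginal P' (fun w => C k t w j) P
    (fun w => S t w j) (exp_weight theta)) => //; first exact: mS.
  move=> A mA; have [_ lawC] := HC k.
  exact: (same_law_marginal _ _ _ _ _ (t, j) _ lawC t0 mA).
rewrite (ge0_integral_same_marginal P' (fun w => S r (pi w) k) P
    (fun w => S r w k) (exp_weight theta))//; first by apply: mSpi; exact: ltW.
  by apply: mS; exact: ltW.
move=> A mA; rewrite -[RHS]piP//.
by rewrite -[X in measurable X]setTI; apply: mS; first exact: ltW.
Qed.

(** Halving the time takes the square root of the mass, and [1 + 2 e <= (1 + e)^2] with
    [e = M / 2^(n+1)] closes the induction. With [M] the mass at time 1 the base case is trivial. *)
Lemma mass_dyadic_le theta : (mass theta 1 < +oo)%E -> exists M : R,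
  forall n, (mass theta (2^-1 ^+ n) <= (1 + M / 2 ^+ n)%:E)%E.
Proof.
move=> fin1; exists (fine (mass theta 1)); elim=> [|n IHn].
  rewrite !expr0 divr1 -[X in (X <= _)%E]fineK.
    by rewrite lee_fin lerDr.
  by rewrite ge0_fin_numE// mass_ge0.
have p2 : 0 < 2^-1 ^+ n.+1 :> R by rewrite exprn_gt0.
have := massD theta _ _ p2 (ltW p2).
have -> : 2^-1 ^+ n.+1 + 2^-1 ^+ n.+1 = 2^-1 ^+ n :> R by rewrite exprS; field.
move=> mE; move: IHn; rewrite mE.
move: (mass_ge0 theta (2^-1 ^+ n.+1)).
case: (mass theta (2^-1 ^+ n.+1)) => [x| |]//=.
rewrite -EFinM !lee_fin => x0 xM.
set M := fine _ in xM *; have M0 : 0 <= M by rewrite fine_ge0// mass_ge0.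
have e0 : 0 <= M / 2 ^+ n.+1 by rewrite divr_ge0// exprn_ge0.
rewrite -(@ler_pXn2r _ 2)// ?nnegrE ?addr_ge0//.
rewrite expr2 (le_trans xM)//.
have -> : M / 2 ^+ n = 2 * (M / 2 ^+ n.+1).
  by rewrite exprS; field; rewrite expf_neq0.
nra.
Qed.

Lemma exists_mass_finite : exists theta : R, (mass theta 1 < +oo)%E.
Proof.
have [theta _ Hfin] := bs_exp_moment bsS; exists theta.
rewrite (le_lt_trans _ Hfin)//.
under [leRHS]eq_integral do rewrite integral_exp_weight.
rewrite integral_nneseries// => [k|k w _]; last exact: exp_weight_ge0.
apply: (measurableT_comp (measurable_exp_weight theta)).
exact: Pspace_process_measurable (bs_process bsS) ler01.
Qed.

Lemma coordinate_scaling t k (A : set (\bar R)) : 0 < t -> measurable A ->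
  P [set w | A (S t w k)] = P [set w | A ((t `^ alpha^-1)%:E * S 1 w k)%E].
Proof.
move=> t0 mA.
have := self_similar_pow alpha0 bsS t [set p | A (p (1, k))] t0.
rewrite /= mulr1; apply; apply: sub_sigma_algebra; exists (1, k), A.
by split => //=.
Qed.

Lemma integral_exp_weight_scaling theta t k : 0 < t ->
  (\int[P]_w exp_weight theta (S t w k) =
   \int[P]_w exp_weight (theta * t `^ alpha^-1) (S 1 w k))%E.
Proof.
move=> t0; have pS := bs_process bsS.
have c0 : 0 < t `^ alpha^-1 by rewrite powR_gt0.
under [RHS]eq_integral do rewrite -exp_weight_scale//.
apply: (ge0_integral_same_marginal P (fun w => S t w k) P
  (fun w => (t `^ alpha^-1)%:E * S 1 w k)%E (exp_weight theta)) => //.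
- by apply: Pspace_process_measurable => //; exact: ltW.
- by apply: measurable_funeM; apply: Pspace_process_measurable.
- exact: measurable_exp_weight.
- exact: exp_weight_ge0.
- by move=> A mA; exact: coordinate_scaling.
Qed.

Lemma bounded_paths_ae : {ae P, forall w,
  (forall t, 0 <= t -> (S t w 0%N < +oo)%E) /\
  (forall t (l : {ptws nat -> \bar R}), 0 < t ->
     (fun s => S s w : {ptws nat -> \bar R}) @ t^'- --> l -> (l 0%N < +oo)%E)}.
Proof.
apply: filterS (no_explosion alpha0 bsS) => w Hw.
by apply: bounded_cadlag => //; have [_ +] := bs_process bsS; exact.
Qed.

Lemma exp_weight_cvg theta (u : nat -> R) (x : \bar R) : u @ \oo --> 0 ->
  (fun n => exp_weight (theta * u n) x) @ \oo --> exp_weight 0 x.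
Proof.
move=> u0; case: x => [r| |] /=; [|exact: cvg_cst..].
apply: cvg_EFin; first by near=> n.
have ul : (fun n => - (theta * u n * r)) @ \oo --> - (0 * r).
  apply: cvgN; apply: cvgM; last exact: cvg_cst.
  by rewrite -(mulr0 theta); apply: cvgM => //; exact: cvg_cst.
exact: cvg_comp _ _ ul (@continuous_expR R _).
Unshelve. all: by end_near. Qed.

Lemma root_pow2_cvg0 : (fun n => (2^-1 ^+ n) `^ alpha^-1 : R) @ \oo --> 0.
Proof.
have -> : (fun n => (2^-1 ^+ n) `^ alpha^-1 : R) = (fun n => (2^-1 `^ alpha^-1) ^+ n).
  apply/funext => n.
  by rewrite -powR_mulrn ?powR_ge0// -powRrM mulrC powRrM powR_mulrn.
apply: cvg_expr; rewrite ger0_norm ?powR_ge0//.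
rewrite -[X in _ < X](congr1 (@^~ alpha^-1) (@powR1 R)); apply: gt0_ltr_powR.
- by rewrite invr_gt0.
- by rewrite nnegrE.
- by rewrite nnegrE.
- by rewrite invf_lt1 ?ltr1n.
Qed.

Lemma second_atom_null : P [set w | (S 1 w 1%N < +oo)%E] = 0%E.
Proof.
have pS := bs_process bsS.
have mS k : measurable_fun setT (fun w => S 1 w k).
  by apply: Pspace_process_measurable.
have [theta Lfin] := exists_mass_finite.
have [M HM] := mass_dyadic_le theta Lfin.
pose u n := (2^-1 ^+ n) `^ alpha^-1 : R.
(* Two terms of the mass suffice to rule out a second atom, and they converge pointwise one by
   one. *)
pose h v w : \bar R := (exp_weight v (S 1 w 0%N) + exp_weight v (S 1 w 1%N))%E.
have mh v : measurable_fun setT (h v).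
  by apply: emeasurable_funD; apply: (measurableT_comp (measurable_exp_weight _)).
have h0 v w : (0 <= h v w)%E by apply: adde_ge0; exact: exp_weight_ge0.
have hcvg w : (fun n => h (theta * u n) w) @ \oo --> h 0 w.
  apply: cvgeD; [|exact: exp_weight_cvg root_pow2_cvg0..].
  by case: (S 1 w 0%N) => [?| |]; case: (S 1 w 1%N).
have le1 n : (\int[P]_w h (theta * u n)%R w <= (1 + M / 2 ^+ n)%:E)%E.
  have p2 : 0 < 2^-1 ^+ n :> R by rewrite exprn_gt0.
  apply: le_trans (HM n).
  rewrite ge0_integralD//; last first.
  all: try by move=> w _; exact: exp_weight_ge0.
  all: try by apply: (measurableT_comp (measurable_exp_weight _)).
  rewrite -!integral_exp_weight_scaling//.
  have i0 k : (0 <= \int[P]_w exp_weight theta (S (2^-1 ^+ n) w k))%E.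
    by apply: integral_ge0 => w _; exact: exp_weight_ge0.
  rewrite /mass (nneseriesD1 (n:=0%N))// leeD2l//.
  by rewrite (nneseriesD1 (n:=1%N))// leeDl// nneseries_ge0.
have int1 : (\int[P]_w h 0%R w <= 1)%E.
  pose b n := (1 + M / 2 ^+ n)%:E.
  have b1 : b @ \oo --> 1%E.
    apply: cvg_EFin; first by near=> n.
    rewrite -[X in _ --> X]addr0 -(mulr0 M); apply: cvgD; first exact: cvg_cst.
    apply: cvgM; first exact: cvg_cst.
    under eq_fun do rewrite -exprVn.
    by apply: cvg_expr; rewrite ger0_norm// invf_lt1 ?ltr1n.
  have -> : (\int[P]_w h 0%R w = \int[P]_w limn_einf (fun n => h (theta * u n)%R w))%E.
    apply: eq_integral => w _.
    by have [-> _] := cvg_limn_einf_sup (hcvg w).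
  (* Atoms at negative positions may have weights above 1, so there is no constant domination;
     Fatou's lemma gives the one inequality that is needed. *)
  apply: le_trans (fatou _ measurableT _ _) _ => //.
  rewrite limn_einf_lim -(cvg_lim _ b1)//.
  apply: lee_lim; [exact: is_cvg_einfs|by apply/cvg_ex; exists 1%E|].
  near=> n; apply: le_trans (le1 n).
  by apply: ereal_inf_lbound; exists n => /=.
have mA k : measurable [set w | (S 1 w k < +oo)%E].
  by rewrite -[X in measurable X]setTI; exact: emeasurable_fun_infty_o.
have h0E w : h 0 w = ((\1_[set w | (S 1 w 0%N < +oo)%E] w)%:E +
                      (\1_[set w | (S 1 w 1%N < +oo)%E] w)%:E)%E.
  have E x : x != -oo%E -> exp_weight 0 x = ((x < +oo)%E%:R%:E : \bar R).
    by case: x => [r| |]//= _; rewrite ?ltry ?ltxx// mul0r oppr0 expR0.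
  by rewrite /h !E ?(process_neqNy _ _ _ _ pS)// !indicE !mem_setE.
move: int1; under eq_integral do rewrite h0E.
rewrite ge0_integralD//; last 2 first.
  by apply/measurable_EFinP; exact: measurable_indic.
  by apply/measurable_EFinP; exact: measurable_indic.
rewrite !integral_indic// !setIT.
have P0 : P [set w | (S 1 w 0%N < +oo)%E] = 1%E.
  apply: probability_ae1 (mA 0%N) _; apply: filterS bounded_paths_ae => w [+ _].
  exact.
rewrite [X in (X + _ <= _)%E](_ : _ = 1%E)// -[leRHS]adde0 leeD2lE// => H.
by apply/eqP; rewrite -measure_le0.
Unshelve. all: by end_near. Qed.

Lemma second_atom_ae t : 0 <= t -> {ae P, forall w, S t w 1%N = +oo%E}.
Proof.
rewrite le_eqVlt => /predU1P[<-|t0].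
  by apply/aeW => w; rewrite (bs_start bsS).
have mA s : 0 <= s -> measurable [set w | (S s w 1%N < +oo)%E].
  move=> s0; rewrite -[X in measurable X]setTI; apply: emeasurable_fun_infty_o => //.
  exact: Pspace_process_measurable (bs_process bsS) s0.
exists [set w | (S t w 1%N < +oo)%E]; split; first by apply: mA; exact: ltW.
  rewrite -second_atom_null.
  have c0 : 0 < t `^ alpha^-1 by rewrite powR_gt0.
  rewrite [LHS](coordinate_scaling _ 1%N [set x | (x < +oo)%E] t0); last first.
    by rewrite -set_itvNyo; exact: emeasurable_itv.
  congr (P _); apply/seteqP; split => w /=; case: (S 1 w 1%N) => [r| |]//=;
  by rewrite ?ltry// ?gt0_muley ?gt0_muleNy ?lte_fin.
by move=> w /= /eqP; rewrite -ltey.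
Qed.

(** A single null set serves all times: if the second atom were finite at [t], it would stay finite
    just after [t] by right continuity, hence at some rational time. Monotonicity of the
    configuration then sends all later atoms to [+oo]. *)
Lemma single_atom_ae : {ae P, forall w,
  (forall t, 0 <= t ->
     S t w 0%N \is a fin_num /\ S t w = single_atom (fine (S t w 0%N))) /\
  (forall t (l : {ptws nat -> \bar R}), 0 < t -> Pspace l ->
     (fun s => S s w : {ptws nat -> \bar R}) @ t^'- --> l -> l 0%N \is a fin_num)}.
Proof.
have pS := bs_process bsS.
have ae1 : {ae P, forall w, forall n,
    if (unpickle n : option rat) is Some q then
      0 <= (ratr q : R) -> S (ratr q) w 1%N = +oo%E else True}.
  apply: ae_foralln => n; case: unpickle => [q|]; last exact/aeW.
  have [q0|q0] := boolP (0 <= (ratr q : R)); last by apply/aeW => w.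
  by apply: filterS (second_atom_ae _ q0) => w ->.
apply: filterS2 bounded_paths_ae ae1 => w [fin1 fin2] Hq.
split => [t t0|t l t0 [lN _ _] /fin2]; last first.
  by move=> /(_ t0) ly; rewrite fin_numE lN /= lt_eqF.
have S0fin : S t w 0%N \is a fin_num.
  by rewrite fin_numE (process_neqNy _ _ _ _ pS)//= lt_eqF// fin1.
split => //.
have S1y : S t w 1%N = +oo%E.
  apply: contrapT => /eqP; rewrite -ltey => lty.
  have [_ /(_ w) [_ /(_ t t0) rc _]] := pS.
  have := ptws_cvg_coord _ _ _ 1%N rc.
  move=> /(_ [set x | (x < +oo)%E]) /= -[|e /= e0 He]; first exact: open_ereal_lt'.
  have /rat_in_itvoo[q] : t < t + e by rewrite ltrDl.
  rewrite in_itv/= => /andP[tq qe].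
  have := Hq (pickle q); rewrite pickleK => /(_ (le_trans t0 (ltW tq))) qy.
  suff : (S (ratr q) w 1%N < +oo)%E by rewrite qy ltxx.
  by apply: He => //=; rewrite distrC gtr0_norm ?subr_gt0// ltrBlDl.
apply/funext => -[|k] /=; first by rewrite fineK.
by apply/eqP; rewrite -leye_eq -S1y; exact: process_homo pS t0 _.
Qed.

End mass.

(** * The position of the single atom as a self-similar Lévy process *)

Section levy.
Context {R : realType}.

Lemma eq_probability_ae {d} {T : measurableType d} (P : probability T R)
    (A B : set T) : measurable A -> measurable B ->
  {ae P, forall w, A w <-> B w} -> P A = P B.
Proof.
move=> mA mB [N [mN N0 HN]].
wlog suff : A B mA mB HN / (P A <= P B)%E => [H|].
  apply/eqP; rewrite eq_le !H//.
  by move=> w /= nBA; apply: HN => /= nAB; apply: nBA; split=> /nAB.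
rewrite -[leRHS]adde0 -N0 (le_trans _ (measureU2 _ _ _))// le_measure ?inE//.
  exact: measurableU.
move=> w Aw; have [Bw|nBw] := pselect (B w); [by left|right].
by apply: HN => /= -[/(_ Aw)].
Qed.

Lemma ae_comp {d d'} {T : measurableType d} {T' : measurableType d'}
    (P : probability T R) (P' : probability T' R) (pi : T' -> T) (Q : T -> Prop) :
  measurable_fun setT pi -> (forall A, measurable A -> P' (pi @^-1` A) = P A) ->
  {ae P, forall w, Q w} -> {ae P', forall w, Q (pi w)}.
Proof.
move=> mpi piP [N [mN N0 HN]]; exists (pi @^-1` N); split.
- by rewrite -[X in measurable X]setTI; exact: mpi.
- by rewrite -N0 -piP.
- by move=> w /= /HN.
Qed.

(** The sets agreeing off [N] with a member of [M] form a sigma-algebra. This exchanges events of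
    the real process, which is modified on a null set, for events of [S]. *)
Lemma sigma_of_agree {T I : Type} {dE} {E : measurableType dE} (D : set I)
    (X : I -> T -> E) (M : set (set T)) (N : set T) :
  sigma_algebra setT M ->
  (forall i A, D i -> measurable A ->
     exists2 A', M A' & forall w, ~ N w -> (A (X i w) <-> A' w)) ->
  forall A, sigma_of D X A -> exists2 A', M A' & forall w, ~ N w -> (A w <-> A' w).
Proof.
move=> [M0 MC MU] MX; apply: smallest_sub; last first.
  by move=> _ [i [A [Di mA ->]]]; exact: MX.
split=> [|A [A' MA AA']|F MF]; first by exists set0.
- exists (setT `\` A'); first exact: MC.
  by move=> w /AA' [h1 h2]; split => -[_ h]; split => // ?; apply: h; auto.
- have /choice[F' HF'] : forall n, exists A', M A' /\ (forall w, ~ N w -> (F n w <-> A' w)).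
    by move=> n; have [A' ? ?] := MF n; exists A'.
  exists (\bigcup_n F' n); first by apply: MU => n; have [] := HF' n.
  move=> w Nw; split => -[n _ Fn]; exists n => //; have [_ /(_ w Nw)[]] := HF' n; auto.
Qed.

Lemma sigma_of_unitP {T : Type} {dE} {E : measurableType dE} (X : T -> E) A :
  sigma_of [set: unit] (fun _ => X) A -> exists2 B, measurable B & A = X @^-1` B.
Proof.
move: A; apply: smallest_sub; last by move=> _ [_ [A [_ mA ->]]]; exists A.
split=> [|A [B mB ->]|F MF].
- by exists set0 => //; rewrite preimage_set0.
- by exists (~` B); [exact: measurableC|rewrite setTD preimage_setC].
- have /choice[F' HF'] : forall n, exists B, measurable B /\ F n = X @^-1` B.
    by move=> n; have [B ? ?] := MF n; exists B.
  exists (\bigcup_n F' n); first by apply: bigcupT_measurable => n; have [] := HF' n.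
  by rewrite preimage_bigcup; apply: eq_bigcupr => n _; have [] := HF' n.
Qed.

Context {d} {T : measurableType d} {P : probability T R} {alpha : R}
  {S : R -> T -> nat -> \bar R}.
Hypothesis alpha0 : 0 < alpha.
Hypothesis bsS : branching_stable P alpha S.

Lemma position_measurable {d'} {T' : measurableType d'}
    (C : R -> T' -> nat -> \bar R) t : Pspace_cadlag_process C -> 0 <= t ->
  measurable_fun setT (fun w => fine (C t w 0%N)).
Proof.
move=> pC t0; apply: measurableT_comp => //.
exact: Pspace_process_measurable pC t0.
Qed.

(** Only two one-coordinate events are transferred by equality in law: coordinate 0 is finite and
    coordinate 1 is [+oo]. Monotonicity settles the remaining coordinates. *)
Lemma copy_single_atom {d'} {T' : measurableType d'} (P' : probability T' R)
    (C : R -> T' -> nat -> \bar R) t : 0 <= t -> Pspace_cadlag_process C ->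
  same_law [set i | 0 <= i.1] P' (coordinates C) P (coordinates S) ->
  {ae P', forall w, C t w = single_atom (fine (C t w 0%N))}.
Proof.
move=> t0 pC lawC.
have ae0 : {ae P', forall w, (C t w 0%N < +oo)%E}.
  have mA : measurable [set x : \bar R | (x < +oo)%E].
    by rewrite -set_itvNyo; exact: emeasurable_itv.
  exists [set w | ~ (C t w 0%N < +oo)%E]; split => //.
    apply: measurableC; rewrite -[X in measurable X]setTI.
    exact: (Pspace_process_measurable _ _ _ pC t0 measurableT _ mA).
  have := same_law_marginal _ _ _ _ _ (t, 0%N) _ lawC t0 (measurableC mA).
  rewrite [X in _ = X](_ : _ = 0%E)//; apply: measure_negligible.
    apply: measurableC; rewrite -[X in measurable X]setTI.
    exact: (Pspace_process_measurable _ _ _ (bs_process bsS) t0 measurableT _ mA).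
  apply: filterS (bounded_paths_ae alpha0 bsS) => w [+ _] /=.
  by apply.
have ae1 : {ae P', forall w, C t w 1%N = +oo%E}.
  have mA : measurable [set x : \bar R | x = +oo%E] by exact: emeasurable_set1.
  exists [set w | ~ (C t w 1%N = +oo)%E]; split => //.
    apply: measurableC; rewrite -[X in measurable X]setTI.
    exact: (Pspace_process_measurable _ _ _ pC t0 measurableT _ mA).
  have := same_law_marginal _ _ _ _ _ (t, 1%N) _ lawC t0 (measurableC mA).
  rewrite [X in _ = X](_ : _ = 0%E)//; apply: measure_negligible.
    apply: measurableC; rewrite -[X in measurable X]setTI.
    exact: (Pspace_process_measurable _ _ _ (bs_process bsS) t0 measurableT _ mA).
  apply: filterS (second_atom_ae alpha0 bsS t t0) => w /=.
  by [].
apply: filterS2 ae0 ae1 => w C0 C1; apply/funext => -[|k] /=.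
  by rewrite fineK// fin_numE (process_neqNy _ _ _ _ pC)//= lt_eqF.
by apply/eqP; rewrite -leye_eq -C1; exact: process_homo pC t0 _.
Qed.

(** With a single parent at time [r], only copy 0 contributes to the superposition, and its position
    at time [t] is the increment. The past is expressed through [S] because the branching property
    gives independence from that sigma-algebra. *)
Lemma increment_law (r t : R) (A : set T) (B : set R) : 0 < r -> 0 <= t ->
  sigma_of [set i : R * nat | 0 <= i.1 <= r] (coordinates S) A -> measurable B ->
  (P (A `&` [set w | B (fine (S (r + t)%R w 0%N) - fine (S r w 0%N))%R]) =
   P A * P [set w | B (fine (S t w 0%N))])%E.
Proof.
move=> r0 t0 sA mB; have rt0 : 0 <= r + t by rewrite addr_ge0// ltW.
have pS := bs_process bsS.
have [d' [T' [P' [pi [C [[mpi piP] HC _ indep super]]]]]] := bs_branching bsS r0.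
have [pC lawC] := HC 0%N.
have mX s : 0 <= s -> measurable_fun setT (fun w => fine (S s w 0%N)).
  exact: position_measurable.
have mA : measurable A.
  apply: sigma_of_measurable sA => i /andP[i0 _].
  exact: Pspace_process_measurable pS i0.
have mI : measurable [set w | B (fine (S (r + t) w 0%N) - fine (S r w 0%N))].
  rewrite -[X in measurable X]setTI; apply: measurable_funB => //; apply: mX => //.
  exact: ltW.
have mpre A' : measurable A' -> measurable (pi @^-1` A').
  by move=> mA'; rewrite -[X in measurable X]setTI; exact: mpi.
have mCB : measurable [set w | B (fine (C 0%N t w 0%N))].
  by rewrite -[X in measurable X]setTI; exact: (position_measurable _ _ pC t0 measurableT _ mB).
(* The event is pulled back to the enlarged space, where the increment can be replaced by the
   position of copy 0. *)
transitivity (P' (pi @^-1` A `&` [set w | B (fine (C 0%N t w 0%N))])).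
  rewrite -piP; last exact: measurableI.
  apply: eq_probability_ae; [exact/mpre/measurableI|by apply: measurableI => //; exact: mpre|].
  have aeS := ae_comp P P' pi _ mpi piP (single_atom_ae alpha0 bsS).
  have aeC := copy_single_atom P' (C 0%N) t t0 pC lawC.
  near=> w.
  have sup : is_superposition (S (t + r) (pi w))
          (fun k => translate (S r (pi w) k) (C k t w)).
    by move: (t) t0; near: w.
  have Hs : forall t, 0 <= t ->
     S t (pi w) 0%N \is a fin_num /\ S t (pi w) = single_atom (fine (S t (pi w) 0%N)).
    by near: w; apply: filterS aeS => w [].
  have C0 : C 0%N t w = single_atom (fine (C 0%N t w 0%N)) by near: w.
  rewrite addrC in sup; move: sup.
  rewrite (Hs (r + t) rt0).2 (Hs r (ltW r0)).2 => /superposition_single_atom.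
  move=> superE.
  have E : fine (S (r + t) (pi w) 0%N) = fine (S r (pi w) 0%N) + fine (C 0%N t w 0%N).
    apply: superE C0 => k j.
    have [pk _] := HC k; exact: process_neqNy pk t0.
  have {}E : fine (C 0%N t w 0%N) = fine (S (r + t) (pi w) 0%N) - fine (S r (pi w) 0%N).
    by rewrite E addrAC subrr add0r.
  split=> -[wA wB]; (split; first exact: wA).
    by apply: (eq_ind_r B wB E).
  by apply: (eq_ind _ B wB _ E).
rewrite setIC indep.
- rewrite piP// muleC; congr (_ * _)%E.
  apply: (same_law_marginal _ _ _ _ _ (t, 0%N) [set x | B (fine x)] lawC t0).
  by rewrite -[X in measurable X]setTI; exact: fine_measurable.
- apply: (sigma_of_gen _ (fun i : nat * (R * nat) => coordinates (C i.1) i.2)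
    (0%N, (t, 0%N)) [set x | B (fine x)]) => //.
  by rewrite -[X in measurable X]setTI; exact: fine_measurable.
- move: A sA {mA mI}; apply: sigma_of_preimage; first exact: smallest_sigma_algebra.
  move=> i A i0 mA.
  exact: (sigma_of_gen _ (coordinates (fun (t : R) w => S t (pi w))) i A i0 mA).
Unshelve. all: by end_near. Qed.

Lemma exists_levy_process : exists2 xi : R -> T -> R,
  levy_process P xi /\
  (forall c : R, 0 < c ->
    same_law [set t | 0 <= t]
      P (fun t : R => xi (c `^ alpha * t)) P (fun (t : R) w => c * xi t w)) &
  {ae P, forall w, forall t : R, 0 <= t -> S t w = single_atom (xi t w)}.
Proof.
have pS := bs_process bsS.
have [N [mN N0 HN]] := single_atom_ae alpha0 bsS.
have {}HN w : ~ N w -> (forall t, 0 <= t ->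
     S t w 0%N \is a fin_num /\ S t w = single_atom (fine (S t w 0%N))) /\
  (forall t (l : {ptws nat -> \bar R}), 0 < t -> Pspace l ->
     (fun s => S s w : {ptws nat -> \bar R}) @ t^'- --> l -> l 0%N \is a fin_num).
  by move=> Nw; apply: contrapT => H; apply: Nw; exact: HN.
(* Setting the path to 0 on [N] makes every path, not just almost every one, càdlàg in the reals;
   [N] does not depend on [t]. *)
pose xi t w := fine (S t w 0%N) * \1_(~` N) w.
have xiE w : ~ N w -> forall t, xi t w = fine (S t w 0%N).
  by move=> Nw t; rewrite /xi indicE mem_set// mulr1.
have xiN w : N w -> forall t, xi t w = 0.
  by move=> Nw t; rewrite /xi indicE memNset ?mulr0//; apply.
have mxi t : 0 <= t -> measurable_fun setT (xi t).
  move=> t0; apply: measurable_funM; first exact: position_measurable pS t0.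
  by apply: measurable_indic; exact: measurableC.
have aeN : {ae P, forall w, ~ N w} by exists N; split => // w /= /contrapT.
have xi0 w : xi 0 w = 0 by rewrite /xi (bs_start bsS) mul0r.
have incr (r t : R) (A : set T) (B : set R) : 0 <= r -> 0 <= t ->
    sigma_of [set u | 0 <= u <= r] xi A -> measurable B ->
    (P (A `&` [set w | B (xi (r + t) w - xi r w)%R]) =
     P A * P [set w | B (xi t w)])%E.
  move=> r0 t0 sA mB; have rt0 : 0 <= r + t by rewrite addr_ge0.
  have mI : measurable [set w | B (xi (r + t) w - xi r w)].
    by rewrite -[X in measurable X]setTI; apply: measurable_funB => //; exact: mxi.
  have mxB : measurable [set w | B (xi t w)].
    by rewrite -[X in measurable X]setTI; exact: mxi.
  move: r0; rewrite le_eqVlt => /predU1P[r0|r0].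
    (* The branching property speaks of [r > 0] only. At [r = 0] the past is trivial, since [xi 0]
       is 0 everywhere. *)
    rewrite -r0 add0r in sA *.
    under eq_set do rewrite xi0 subr0.
    suff [->|->] : A = set0 \/ A = setT.
    - by rewrite set0I measure0 mul0e.
    - by rewrite setTI probability_setT mul1e.
    move: A sA; apply: smallest_sub; last first.
      move=> _ [u [A [/= u0 mA ->]]].
      have -> : u = 0 by apply/eqP; rewrite eq_le andbC.
      have [A0|A0] := pselect (A 0); [right|left];
        by apply/seteqP; split => w; rewrite /= xi0.
    split=> [|A [] ->|F HF]; first by left.
    - by right; rewrite setD0.
    - by left; rewrite setDv.
    - have [[n Fn]|nF] := pselect (exists n, F n = setT).
        by right; apply/seteqP; split => // w _; exists n => //; rewrite Fn.
      left; apply/seteqP; split => // w [n _ Fnw]; have [Fn|Fn] := HF n.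
        by rewrite -Fn.
      by exfalso; apply: nF; exists n.
  have [A' sA' AA'] : exists2 A',
      sigma_of [set i : R * nat | 0 <= i.1 <= r] (coordinates S) A' & forall w, ~ N w -> (A w <-> A' w).
    move: A sA {mI}; apply: sigma_of_agree; first exact: smallest_sigma_algebra.
    move=> u A u0 mA; exists ((coordinates S (u, 0%N)) @^-1` [set x | A (fine x)]).
      apply: sigma_of_gen => //.
      by rewrite -[X in measurable X]setTI; exact: fine_measurable.
    by move=> w Nw; rewrite xiE.
  have mA : measurable A.
    by apply: sigma_of_measurable sA => u /andP[u0 _]; exact: mxi.
  have mA' : measurable A'.
    apply: sigma_of_measurable sA' => i /andP[i0 _].
    exact: Pspace_process_measurable pS i0.
  have mI' : measurable [set w | B (fine (S (r + t) w 0%N) - fine (S r w 0%N))].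
    rewrite -[X in measurable X]setTI; apply: measurable_funB => //.
      exact: position_measurable pS rt0.
    exact: position_measurable pS (ltW r0).
  have mB' : measurable [set w | B (fine (S t w 0%N))].
    rewrite -[X in measurable X]setTI.
    exact: (position_measurable _ _ pS t0 measurableT _ mB).
  rewrite (eq_probability_ae P A A')//; last by apply: filterS aeN => w /AA'.
  rewrite (eq_probability_ae P [set w | B (xi t w)] _ mxB mB'); last first.
    by apply: filterS aeN => w Nw; rewrite /= xiE.
  rewrite -(increment_law r t A' B r0 t0 sA' mB).
  apply: eq_probability_ae; [exact: measurableI..|].
  by apply: filterS aeN => w Nw; rewrite /= /setI/= !xiE// AA'.
exists xi; last first.
  by apply: filterS aeN => w Nw t t0; rewrite xiE//; have [/(_ t t0)[]] := HN w Nw.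
split.
  split => //.
  - move=> w; have [Nw|Nw] := pselect (N w).
      have -> : xi ^~ w = cst 0 by apply/funext => t; exact: xiN.
      split=> // t _; first exact: cvg_cst.
      by exists 0 => //; exact: cvg_cst.
    have -> : xi ^~ w = (fun t => fine (S t w 0%N)) by apply/funext => t; exact: xiE.
    have [fin1 fin2] := HN w Nw.
    have [_ /(_ w) [_ rc ll]] := pS.
    split=> // t t0.
      have St := ptws_cvg_coord _ _ _ 0%N (rc t t0).
      rewrite -(fineK (proj1 (fin1 t t0))) in St.
      exact: fine_cvg St.
    have [l Pl tl] := ll t t0; exists (fine (l 0%N)) => //.
    have St := ptws_cvg_coord _ _ _ 0%N tl.
    rewrite -(fineK (fin2 t l t0 Pl tl)) in St.
    exact: fine_cvg St.
  - move=> s t s0 t0 A B sA /sigma_of_unitP[B' mB' ->].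
    rewrite [LHS](incr t s A B')//; congr (_ * _)%E.
    have := incr t s setT B' t0 s0 _ mB'.
    rewrite setTI probability_setT mul1e => ->//.
    by rewrite -setC0; apply: sigma_algebraC; exact: sigma_algebra0.
  - move=> s t s0 t0 A mA.
    have := incr t s setT A t0 s0 _ mA.
    rewrite setTI probability_setT mul1e => ->//.
    by rewrite -setC0; apply: sigma_algebraC; exact: sigma_algebra0.
move=> c c0 B sB.
(* The map [h] pulls path events of [xi] back to path events of [S]. It respects scaling because
   [fine] commutes with multiplication by [c > 0], the infinite values giving 0 on both sides. *)
pose h (p : R * nat -> \bar R) : R -> R := fun t => fine (p (t, 0%N)).
have sB' : path_sigma [set i | 0 <= i.1] (h @^-1` B).
  move: B sB; apply: (sigma_of_preimage _ (fun t (p : R -> R) => p t) h).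
    exact: smallest_sigma_algebra.
  move=> t A t0 mA.
  apply: (sigma_of_gen _ (fun i (p : R * nat -> \bar R) => p i) (t, 0%N)
    [set x | A (fine x)]) => //.
  by rewrite -[X in measurable X]setTI; exact: fine_measurable.
have c1 : 0 <= c `^ alpha by exact: powR_ge0.
have := bs_selfsimilar bsS c0 sB'.
have fineM (x : \bar R) : fine (c%:E * x)%E = c * fine x.
  case: x => [x| |] //=; rewrite mulr0.
    by rewrite gt0_muley ?lte_fin.
  by rewrite gt0_muleNy ?lte_fin.
rewrite (eq_probability_ae P _ [set w | B (fun t => xi (c `^ alpha * t) w)]).
- move=> ->; apply: eq_probability_ae.
  + apply: (@measurable_path_event _ _ _ _ _ [set i | 0 <= i.1]
      (coordinates (fun t w => dilate c (S t w)))) sB' => i i0.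
    by apply: measurable_funeM; exact: Pspace_process_measurable pS i0.
  + apply: (@measurable_path_event _ _ _ _ _ [set t | 0 <= t]
      (fun t w => c * xi t w)) sB => t t0.
    by apply: measurable_funM => //; exact: mxi.
  + apply: filterS aeN => w Nw /=.
    rewrite [X in B X <-> _](_ : _ = (fun t => c * xi t w))//.
    by apply/funext => t; rewrite /h/= fineM xiE.
- apply: (@measurable_path_event _ _ _ _ _ [set i | 0 <= i.1]
      (coordinates (fun t => S (c `^ alpha * t)))) sB' => i i0.
  by apply: Pspace_process_measurable pS _; rewrite mulr_ge0.
- apply: (@measurable_path_event _ _ _ _ _ [set t | 0 <= t]
    (fun t w => xi (c `^ alpha * t) w)) sB => t t0.
  by apply: mxi; rewrite mulr_ge0.
- apply: filterS aeN => w Nw /=.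
  rewrite [X in B X <-> _](_ : _ = (fun t => xi (c `^ alpha * t) w))//.
  by apply/funext => t; rewrite /h/= xiE.
Qed.

End levy.

(** * Multiplicative functions with slow growth of [1 - g] under dilation *)

Section multiplicative_modulus.
Context {R : realType}.

(** This bound and the next reflect [1 - x^n = (1 - x) (1 + x + ... + x^(n-1))], whose [n] summands
    lie between [x^n] and 1. *)
Lemma one_subX_le (x : R) n : 0 <= x <= 1 -> 1 - x ^+ n <= n%:R * (1 - x).
Proof.
move=> /andP[x0 x1]; elim: n => [|n IH]; first by rewrite expr0 subrr mul0r.
have xn1 : x ^+ n <= 1 by exact: exprn_ile1.
have xn0 : 0 <= x ^+ n by exact: exprn_ge0.
rewrite exprS -natr1; nra.
Qed.

Lemma one_subX_ge (x : R) n : 0 <= x <= 1 ->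
  n%:R * x ^+ n * (1 - x) <= 1 - x ^+ n.
Proof.
move=> /andP[x0 x1]; elim: n => [|n IH]; first by rewrite expr0 subrr !mul0r.
have xn0 : 0 <= x ^+ n by exact: exprn_ge0.
have n0 : 0 <= n%:R :> R by [].
have xS : x ^+ n.+1 <= x ^+ n by rewrite exprS ler_piMl.
rewrite -natr1.
have step : (n%:R + 1) * x ^+ n.+1 * (1 - x) <= (n%:R + 1) * x ^+ n * (1 - x).
  by rewrite ler_wpM2r ?subr_ge0// ler_wpM2l// addr_ge0.
have -> : 1 - x ^+ n.+1 = (1 - x ^+ n) + x ^+ n * (1 - x) by rewrite exprS; ring.
nra.
Qed.

Lemma multiplicative_eq1 (g : R -> R) (c : R) : 4 < c ->
  (forall t, 0 < t -> 0 <= g t <= 1) ->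
  (forall s t, 0 < s -> 0 < t -> g (s + t) = g s * g t) ->
  (forall t, 0 < t -> 1 - g (c * t) <= 4 * (1 - g t)) ->
  (forall gam, gam < 1 -> exists2 t, 0 < t & gam <= g t) ->
  g 1 = 1.
Proof.
move=> c4 g01 gD gc g1.
(* With [p / q.+1 = 4 + 1 / q.+1 <= c], [1 - g] grows between [s] and [p s] by a
   factor close to [p], but between [s] and [q.+1 s] by at most [q.+1]. *)
have gX s n : 0 < s -> g (n.+1%:R * s) = g s ^+ n.+1.
  move=> s0; elim: n => [|n IH]; first by rewrite mul1r.
  by rewrite -natr1 mulrDl mul1r gD// ?mulr_gt0// IH -exprSr.
have gmono s t : 0 < s -> s <= t -> g t <= g s.
  move=> s0; rewrite le_eqVlt => /predU1P[->//|st].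
  have -> : t = s + (t - s) by rewrite addrC subrK.
  have ts : 0 < t - s by rewrite subr_gt0.
  have /andP[gs0 _] := g01 s s0; have /andP[_ gts] := g01 _ ts.
  by rewrite gD// ler_piMr.
have [q qc] : exists q : nat, (4 * q.+1 + 1)%:R <= c * q.+1%:R.
  exists (Num.bound (c - 4)^-1).
  have c40 : 0 < c - 4 by rewrite subr_gt0.
  have := archi_boundP (x := (c - 4)^-1); rewrite invr_ge0 (ltW c40) => /(_ isT).
  move: (Num.bound _) => n /ltW; rewrite -div1r ler_pdivrMr// => H.
  rewrite natrD natrM -natr1; nra.
set p := (4 * q.+1 + 1)%N in qc.
have pE : p%:R = 4 * q.+1%:R + 1 :> R by rewrite /p natrD natrM.
have q1 : 1 <= q.+1%:R :> R by rewrite ler1n.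
have p0 : 0 < p%:R :> R by rewrite pE; lra.
(* Chosen so that [p * gam = 4 (q + 1) + 1/2], which still exceeds [4 (q + 1)]. *)
pose gam := (p%:R - 2^-1) / p%:R : R.
have gam1 : gam < 1 by rewrite /gam ltr_pdivrMr//; lra.
have [t0 t00 gt0] := g1 gam gam1.
have c0 : 0 < c by lra.
(* With these choices [p s <= c (q + 1) s = t0], so monotonicity gives [g(s)^p >= gam]. *)
pose t := t0 / c; have t_gt0 : 0 < t by rewrite divr_gt0.
pose s := t / q.+1%:R; have s0 : 0 < s by rewrite divr_gt0//; lra.
have /andP[gs0 gs1] := g01 s s0.
have qs : t = q.+1%:R * s by rewrite /s; field; lra.
have ps : g (p%:R * s) = g s ^+ p by rewrite /p addn1 gX.
have pst : p%:R * s <= t0.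
  have -> : t0 = c * q.+1%:R * s by rewrite -mulrA -qs /t; field; lra.
  by rewrite ler_wpM2r// ltW.
have ps0 : 0 < p%:R * s by rewrite mulr_gt0.
have gps : gam <= g s ^+ p by rewrite -ps (le_trans gt0)// gmono.
have B1 := one_subX_ge (g s) p.
have {}B1 : p%:R * g s ^+ p * (1 - g s) <= 1 - g s ^+ p by apply: B1; rewrite gs0.
have B2 : 1 - g s ^+ q.+1 <= q.+1%:R * (1 - g s) by apply: one_subX_le; rewrite gs0.
have B3 : 1 - g s ^+ p <= 4 * (1 - g s ^+ q.+1).
  rewrite -ps -gX// -qs (le_trans _ (gc t t_gt0))// lerD2l lerN2 gmono//.
  by rewrite [leRHS](_ : _ = t0)// /t; field; lra.
have B4 : p%:R * gam * (1 - g s) <= p%:R * g s ^+ p * (1 - g s).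
  by rewrite ler_wpM2r ?subr_ge0// ler_wpM2l// ltW.
have pgam : p%:R * gam = 4 * q.+1%:R + 2^-1 by rewrite /gam pE; field; lra.
(* The bounds chain to [(4 (q + 1) + 1/2) (1 - g s) <= 4 (q + 1) (1 - g s)]. *)
have gs : g s = 1.
  apply/eqP; rewrite eq_le gs1/=; move: B4; rewrite pgam => B4; nra.
have [n ns] : exists n : nat, 1 <= n.+1%:R * s.
  exists (Num.bound s^-1); have := archi_boundP (x := s^-1).
  rewrite invr_ge0 (ltW s0) => /(_ isT) /ltW H.
  rewrite -ler_pdivrMr// div1r (le_trans H)// ler_nat//.
apply/eqP; rewrite eq_le; have /andP[_ ->] := g01 1 ltr01 => /=.
by rewrite (le_trans _ (gmono 1 _ ltr01 ns))// gX// gs expr1n.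
Qed.

End multiplicative_modulus.

(** * The modulus of the characteristic function, in real terms *)

Section characteristic_modulus.
Context {R : realType} {d} {T : measurableType d} (P : probability T R).
Implicit Types X Y : T -> R.

Definition cosE X : R := \int[P]_w cos (X w).
Definition sinE X : R := \int[P]_w sin (X w).
Definition char_mod X : R := Num.sqrt (cosE X ^+ 2 + sinE X ^+ 2).

Lemma bounded1_integrable (f : T -> R) : measurable_fun setT f ->
  (forall w, `|f w| <= 1) -> P.-integrable setT (EFin \o f).
Proof.
move=> mf f1; apply: measurable_bounded_integrable => //.
  exact: le_lt_trans (probability_le1 P measurableT) (ltry 1).
by exists 1; split => // x x1 w _; apply: (le_trans (f1 w)); exact: ltW.
Qed.

Lemma measurable_cosR : measurable_fun setT (@cos R).
Proof. by apply: continuous_measurable_fun; exact: continuous_cos. Qed.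

Lemma measurable_sinR : measurable_fun setT (@sin R).
Proof. by apply: continuous_measurable_fun; exact: continuous_sin. Qed.

Lemma measurable_cos_comp X : measurable_fun setT X ->
  measurable_fun setT (fun w => cos (X w)).
Proof. by move=> mX; apply: (measurableT_comp measurable_cosR). Qed.

Lemma measurable_sin_comp X : measurable_fun setT X ->
  measurable_fun setT (fun w => sin (X w)).
Proof. by move=> mX; apply: (measurableT_comp measurable_sinR). Qed.

Lemma cos_integrable X : measurable_fun setT X ->
  P.-integrable setT (EFin \o (fun w => cos (X w))).
Proof.
move=> mX; apply: bounded1_integrable => [|w]; last exact: cos_max.
exact: measurable_cos_comp.
Qed.

Lemma sin_integrable X : measurable_fun setT X ->
  P.-integrable setT (EFin \o (fun w => sin (X w))).
Proof.
move=> mX; apply: bounded1_integrable => [|w]; last exact: sin_max.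
exact: measurable_sin_comp.
Qed.

Lemma Rintegral_lin (f g : T -> R) p q :
  P.-integrable setT (EFin \o f) -> P.-integrable setT (EFin \o g) ->
  \int[P]_w (p * f w + q * g w) = p * \int[P]_w f w + q * \int[P]_w g w.
Proof.
move=> fi gi; rewrite RintegralD//.
- by rewrite !RintegralZl.
- exact: (integrableZl measurableT p fi).
- exact: (integrableZl measurableT q gi).
Qed.

Lemma integrable_lin (f g : T -> R) p q :
  P.-integrable setT (EFin \o f) -> P.-integrable setT (EFin \o g) ->
  P.-integrable setT (EFin \o (fun w => p * f w + q * g w)).
Proof.
move=> fi gi.
have := integrableD measurableT (integrableZl measurableT p fi)
  (integrableZl measurableT q gi).
by apply: eq_integrable.
Qed.

Lemma Rintegral1 : \int[P]_w (1 : R) = 1.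
Proof.
rewrite Rintegral_cst// mul1r.
by have -> : fine (P setT) = 1 by rewrite probability_setT.
Qed.

Lemma integrable1 : P.-integrable setT (EFin \o (fun _ => 1 : R)).
Proof. by apply: bounded1_integrable => // w; rewrite normr1. Qed.

Lemma Rintegral_mul_indep (f g : T -> R) :
  measurable_fun setT f -> measurable_fun setT g ->
  (forall w, `|f w| <= 1) -> (forall w, `|g w| <= 1) ->
  (forall A B, measurable A -> measurable B ->
    P (f @^-1` A `&` g @^-1` B) = P (f @^-1` A) * P (g @^-1` B))%E ->
  \int[P]_w (f w * g w) = (\int[P]_w f w) * \int[P]_w g w.
Proof.
move=> mf mg f1 g1 fg.
have fi := bounded1_integrable f mf f1.
have gi := bounded1_integrable g mg g1.
(* The product formula for nonnegative variables is applied to [1 + f], [1 + g]. *)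
have f0 w : 0 <= 1 + f w by have := f1 w; rewrite ler_norml => /andP[]; lra.
have g0 w : 0 <= 1 + g w by have := g1 w; rewrite ler_norml => /andP[]; lra.
have fgi : P.-integrable setT (EFin \o (fun w => f w * g w)).
  apply: bounded1_integrable; first exact: measurable_funM.
  by move=> w; rewrite normrM mulr_ile1.
have m1 : measurable_fun setT (fun x : R => (1 + x)%:E).
  by apply/measurable_EFinP; exact: measurable_funD.
have mul : \int[P]_w ((1 + f w) * (1 + g w)) =
           (\int[P]_w (1 + f w)) * \int[P]_w (1 + g w).
  rewrite /Rintegral.
  have -> : (\int[P]_w ((1 + f w) * (1 + g w))%:E =
    \int[P]_w ((1 + f w)%:E * (1 + g w)%:E))%E by [].
  rewrite (ge0_integral_mul_indep P (fun w => (1 + f w)%:E) (fun w => (1 + g w)%:E)).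
  - rewrite fineM//; apply: integrable_fin_num => //.
    + have := integrable_lin _ _ 1 1 integrable1 fi.
      by apply: eq_integrable => // w _; rewrite /= !mul1r.
    + have := integrable_lin _ _ 1 1 integrable1 gi.
      by apply: eq_integrable => // w _; rewrite /= !mul1r.
  - exact: (measurableT_comp m1 mf).
  - exact: (measurableT_comp m1 mg).
  - by move=> w; rewrite lee_fin.
  - by move=> w; rewrite lee_fin.
  - move=> A B mA mB.
    by apply: (fg ((fun x : R => (1 + x)%:E) @^-1` A) ((fun x : R => (1 + x)%:E) @^-1` B));
      rewrite -[X in measurable X]setTI; exact: m1.
have E1 (h : T -> R) : P.-integrable setT (EFin \o h) ->
    \int[P]_w (1 + h w) = 1 + \int[P]_w h w.
  by move=> hi; rewrite RintegralD ?Rintegral1//; exact: integrable1.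
have E2 : \int[P]_w ((1 + f w) * (1 + g w)) =
    1 + \int[P]_w f w + \int[P]_w g w + \int[P]_w (f w * g w).
  transitivity (\int[P]_w (1 + (1 * f w + 1 * (1 * g w + 1 * (f w * g w))))).
    by apply: eq_Rintegral => w _; ring.
  have i1 := integrable_lin _ _ 1 1 gi fgi.
  have i2 := integrable_lin _ _ 1 1 fi i1.
  by rewrite E1// Rintegral_lin// Rintegral_lin// !mul1r !addrA.
move: mul; rewrite E2 !E1// mulrDl mul1r mulrDr mulr1.
set a := \int[P]_w f w; set b := \int[P]_w g w; set c := \int[P]_w (f w * g w).
by move=> H; lra.
Qed.

Definition rv_indep X Y := forall A B, measurable A -> measurable B ->
  (P (X @^-1` A `&` Y @^-1` B) = P (X @^-1` A) * P (Y @^-1` B))%E.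

Lemma Rintegral_comp_indep (f g : R -> R) X Y :
  measurable_fun setT f -> measurable_fun setT g ->
  (forall w, `|f w| <= 1) -> (forall w, `|g w| <= 1) ->
  measurable_fun setT X -> measurable_fun setT Y -> rv_indep X Y ->
  \int[P]_w (f (X w) * g (Y w)) = (\int[P]_w f (X w)) * \int[P]_w g (Y w).
Proof.
move=> mf mg f1 g1 mX mY XY; apply: Rintegral_mul_indep => //.
- exact: measurableT_comp.
- exact: measurableT_comp.
- by move=> A B mA mB; apply: (XY (f @^-1` A) (g @^-1` B));
    rewrite -[X in measurable X]setTI; [exact: mf|exact: mg].
Qed.

Lemma mul_comp_integrable (f g : R -> R) X Y :
  measurable_fun setT X -> measurable_fun setT Y ->
  measurable_fun setT f -> measurable_fun setT g ->
  (forall x, `|f x| <= 1) -> (forall x, `|g x| <= 1) ->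
  P.-integrable setT (EFin \o (fun w => f (X w) * g (Y w))).
Proof.
move=> mX mY mf mg f1 g1; apply: bounded1_integrable => [|w].
  by apply: measurable_funM; exact: measurableT_comp.
by rewrite normrM mulr_ile1.
Qed.

Lemma cosED X Y : measurable_fun setT X -> measurable_fun setT Y ->
  rv_indep X Y -> cosE (fun w => X w + Y w) = cosE X * cosE Y - sinE X * sinE Y.
Proof.
move=> mX mY XY.
have mc := measurable_cosR; have ms := measurable_sinR.
have c1 := @cos_max R; have s1 := @sin_max R.
rewrite /cosE /sinE -!Rintegral_comp_indep// -RintegralB//; [|exact: mul_comp_integrable..].
by apply: eq_Rintegral => w _; exact: cosD.
Qed.

Lemma sinED X Y : measurable_fun setT X -> measurable_fun setT Y ->
  rv_indep X Y -> sinE (fun w => X w + Y w) = sinE X * cosE Y + cosE X * sinE Y.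
Proof.
move=> mX mY XY.
have mc := measurable_cosR; have ms := measurable_sinR.
have c1 := @cos_max R; have s1 := @sin_max R.
rewrite /cosE /sinE -!Rintegral_comp_indep// -RintegralD//; [|exact: mul_comp_integrable..].
by apply: eq_Rintegral => w _; exact: sinD.
Qed.

Lemma char_mod_add X Y : measurable_fun setT X -> measurable_fun setT Y ->
  rv_indep X Y -> char_mod (fun w => X w + Y w) = char_mod X * char_mod Y.
Proof.
move=> mX mY XY; rewrite /char_mod cosED// sinED// -sqrtrM; last first.
  by rewrite addr_ge0// sqr_ge0.
by congr Num.sqrt; ring.
Qed.

Lemma char_mod_ge0 X : 0 <= char_mod X.
Proof. exact: sqrtr_ge0. Qed.

Lemma char_mod_sqr X : char_mod X ^+ 2 = cosE X ^+ 2 + sinE X ^+ 2.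
Proof. by rewrite sqr_sqrtr// addr_ge0// sqr_ge0. Qed.

(** Here [(p, q)] is [(cos c, sin c)] for an argument [c] of the characteristic function, so the
    modulus becomes the expectation of [cos (X - c)]. When the modulus is 0 any unit vector
    serves. *)
Lemma phase X : exists p q, p ^+ 2 + q ^+ 2 = 1 /\
  p * cosE X + q * sinE X = char_mod X.
Proof.
have [m0|m0] := eqVneq (char_mod X) 0.
  exists 1, 0; split; first by ring.
  have := char_mod_sqr X; rewrite m0 => H.
  have : cosE X ^+ 2 = 0 by have := sqr_ge0 (cosE X); have := sqr_ge0 (sinE X); nra.
  by move/eqP; rewrite sqrf_eq0 => /eqP->; ring.
exists (cosE X / char_mod X), (sinE X / char_mod X).
have H := char_mod_sqr X; split.
  by rewrite !expr_div_n -mulrDl -H divff// sqrf_eq0.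
have -> : cosE X / char_mod X * cosE X + sinE X / char_mod X * sinE X =
  (cosE X ^+ 2 + sinE X ^+ 2) / char_mod X by ring.
by rewrite -H expr2 mulfK.
Qed.

(** Cauchy-Schwarz in the plane, by Lagrange's identity. Together with [phase] it presents the
    modulus as a maximum of expectations over unit vectors. *)
Lemma char_mod_ge X p q : p ^+ 2 + q ^+ 2 = 1 ->
  p * cosE X + q * sinE X <= char_mod X.
Proof.
move=> pq; rewrite (le_trans (ler_norm _))// -sqrtr_sqr ler_sqrt; last first.
  by rewrite addr_ge0// sqr_ge0.
have := sqr_ge0 (p * sinE X - q * cosE X); nra.
Qed.

Lemma cosE_le_char_mod X : cosE X <= char_mod X.
Proof.
by have := char_mod_ge X 1 0; rewrite mul1r mul0r addr0; apply; ring.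
Qed.

Lemma phase_le1 (p q x : R) : p ^+ 2 + q ^+ 2 = 1 -> p * cos x + q * sin x <= 1.
Proof.
move=> pq; have := cos2Dsin2 x.
have := sqr_ge0 (p - cos x); have := sqr_ge0 (q - sin x); nra.
Qed.

Lemma char_mod_le1 X : measurable_fun setT X -> char_mod X <= 1.
Proof.
move=> mX; have [p [q [pq <-]]] := phase X.
have ci := cos_integrable X mX; have si := sin_integrable X mX.
rewrite -Rintegral_lin// -[leRHS]Rintegral1 le_Rintegral//.
- exact: integrable_lin.
- exact: integrable1.
- by move=> w _; exact: phase_le1.
Qed.

(* Integrates [1 - cos (2 (v - c)) <= 4 (1 - cos (v - c))], where [c] is the
   argument of the characteristic function. *)
Lemma char_mod_double X : measurable_fun setT X ->
  1 - char_mod (fun w => 2 * X w) <= 4 * (1 - char_mod X).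
Proof.
move=> mX; have [p [q [pq E]]] := phase X.
have mX2 : measurable_fun setT (fun w => 2 * X w) by exact: measurable_funM.
have ci := cos_integrable X mX; have si := sin_integrable X mX.
have ci2 := cos_integrable _ mX2; have si2 := sin_integrable _ mX2.
(* This is the unit vector of the doubled angle [2 c]. It need not be the optimal one for [2 * X],
   but a lower bound on that modulus is enough. *)
have pq2 : (p ^+ 2 - q ^+ 2) ^+ 2 + (2 * p * q) ^+ 2 = 1.
  have -> : (p ^+ 2 - q ^+ 2) ^+ 2 + (2 * p * q) ^+ 2 = (p ^+ 2 + q ^+ 2) ^+ 2 by ring.
  by rewrite pq expr1n.
have := char_mod_ge (fun w => 2 * X w) _ _ pq2.
suff : 4 * char_mod X - 3 <= (p ^+ 2 - q ^+ 2) * cosE (fun w => 2 * X w) +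
    2 * p * q * sinE (fun w => 2 * X w) by lra.
rewrite -E -Rintegral_lin// -Rintegral_lin//.
have i1 := integrable_lin _ _ p q ci si.
have -> : 4 * \int[P]_w (p * cos (X w) + q * sin (X w)) - 3 =
    \int[P]_w (4 * (p * cos (X w) + q * sin (X w)) + (- 3) * 1).
  by rewrite [RHS](Rintegral_lin _ _ 4 (- 3) i1 integrable1) Rintegral1 mulr1.
apply: le_Rintegral => //.
- by apply: integrable_lin => //; exact: integrable1.
- exact: integrable_lin.
- move=> w _.
  have c2 : cos (2 * X w) = 2 * cos (X w) ^+ 2 - 1.
    by rewrite mulr_natl cos_mulr2n mulr_natl.
  have s2 : sin (2 * X w) = 2 * (cos (X w) * sin (X w)).
    by rewrite mulr_natl sin_mulr2n mulr_natl.
  rewrite c2 s2; have := cos2Dsin2 (X w).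
  move: (cos (X w)) (sin (X w)) => c s cs.
  (* With [y = p c + q s] the claim reduces to [4 y - 3 <= 2 y^2 - 1], that is
     [0 <= 2 (y - 1)^2]. *)
  have -> : (p ^+ 2 - q ^+ 2) * (2 * c ^+ 2 - 1) + 2 * p * q * (2 * (c * s)) =
    2 * (p * c + q * s) ^+ 2 - (p ^+ 2 + q ^+ 2)
    + 2 * q ^+ 2 * (1 - (c ^+ 2 + s ^+ 2)) by ring.
  rewrite cs pq; have := sqr_ge0 (p * c + q * s - 1); nra.
Qed.

(** The nonnegative variable [1 - (p cos X + q sin X)] has integral 0, hence vanishes almost
    everywhere, and two unit vectors with scalar product 1 are equal. *)
Lemma char_mod1 X : measurable_fun setT X -> char_mod X = 1 ->
  exists p q, {ae P, forall w, cos (X w) = p /\ sin (X w) = q}.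
Proof.
move=> mX X1; have [p [q [pq E]]] := phase X; exists p, q.
have ci := cos_integrable X mX; have si := sin_integrable X mX.
have i1 := integrable_lin _ _ p q ci si.
have i2 := integrable_lin _ _ 1 (-1) integrable1 i1.
pose G w := 1 * 1 + -1 * (p * cos (X w) + q * sin (X w)).
have G0 w : 0 <= G w by have := phase_le1 p q (X w) pq; rewrite /G; lra.
have I0 : \int[P]_w G w = 0.
  by rewrite (Rintegral_lin _ _ 1 (-1) integrable1 i1) Rintegral1 Rintegral_lin// E X1; ring.
have mg : measurable_fun setT (EFin \o G) by have /integrableP[] := i2.
have : (\int[P]_w `|(EFin \o G) w| = 0)%E.
  have GE : (\int[P]_w `|(EFin \o G) w| = \int[P]_w (G w)%:E)%E.
    by apply: eq_integral => w _; rewrite /= ger0_norm.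
  rewrite GE -(fineK (integrable_fin_num measurableT i2)).
  by congr (_%:E).
move/(ae_eq_integral_abs P measurableT mg); apply: filterS => w /= /(_ I) [].
rewrite /G => H.
have := cos2Dsin2 (X w); move: (cos (X w)) (sin (X w)) H => c s H cs.
have : (c - p) ^+ 2 + (s - q) ^+ 2 = 0 by nra.
move=> /eqP; rewrite paddr_eq0 ?sqr_ge0// !sqrf_eq0 !subr_eq0.
by move=> /andP[/eqP-> /eqP->].
Qed.

End characteristic_modulus.

(** * Triviality of the Lévy process for index above 2 *)

Section stable_above2.
Context {R : realType} {d} {T : measurableType d} {P : probability T R}.

Lemma Rintegral_same_law (X Y : T -> R) (f : R -> R) :
  measurable_fun setT X -> measurable_fun setT Y -> measurable_fun setT f ->
  (forall x, `|f x| <= 1) ->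
  (forall A, measurable A -> P (X @^-1` A) = P (Y @^-1` A)) ->
  \int[P]_w f (X w) = \int[P]_w f (Y w).
Proof.
move=> mX mY mf f1 XY.
have fi Z : measurable_fun setT Z -> P.-integrable setT (EFin \o (fun w => f (Z w))).
  by move=> mZ; apply: bounded1_integrable => //; exact: measurableT_comp.
have E1 Z : measurable_fun setT Z -> \int[P]_w (1 + f (Z w)) = 1 + \int[P]_w f (Z w).
  by move=> mZ; rewrite RintegralD ?Rintegral1//; [exact: integrable1|exact: fi].
apply: (addrI 1); rewrite -!E1//; congr fine.
apply: (ge0_integral_same_marginal P X P Y (fun x => (1 + f x)%:E)) => //.
  by apply/measurable_EFinP; exact: measurable_funD.
by move=> x; rewrite lee_fin; have := f1 x; rewrite ler_norml => /andP[]; lra.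
Qed.

Lemma char_mod_same_law (X Y : T -> R) :
  measurable_fun setT X -> measurable_fun setT Y ->
  (forall A, measurable A -> P (X @^-1` A) = P (Y @^-1` A)) ->
  char_mod P X = char_mod P Y.
Proof.
move=> mX mY XY; rewrite /char_mod; congr (Num.sqrt (_ ^+ 2 + _ ^+ 2)).
  by apply: (Rintegral_same_law X Y (@cos R)) => //;
    [exact: measurable_cosR|exact: cos_max].
by apply: (Rintegral_same_law X Y (@sin R)) => //;
  [exact: measurable_sinR|exact: sin_max].
Qed.

Context {alpha : R} {xi : R -> T -> R}.
Hypothesis alpha2 : 2 < alpha.
Hypothesis levy : levy_process P xi.
Hypothesis scaling : forall c : R, 0 < c ->
  same_law [set t | 0 <= t]
    P (fun t : R => xi (c `^ alpha * t)) P (fun (t : R) w => c * xi t w).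

Lemma char_mod_scaling_eq1 l : char_mod P (fun w => l * xi 1 w) = 1.
Proof.
have mxi t : 0 <= t -> measurable_fun setT (xi t) by exact: levy_measurable levy t.
have mlxi t : 0 <= t -> measurable_fun setT (fun w => l * xi t w).
  by move=> t0; apply: measurable_funM => //; exact: mxi.
have ml : measurable_fun setT (fun x : R => l * x) by exact: measurable_funM.
apply: (multiplicative_eq1 (fun t => char_mod P (fun w => l * xi t w)) (2 `^ alpha)).
- rewrite -(@ltr_ln R)?posrE ?powR_gt0// ln_powR.
  have -> : 4 = 2 ^+ 2 :> R by ring.
  by rewrite lnXn// -(mulr_natl (ln 2)) ltr_pM2r// ln_gt0// ltr1n.
- move=> t t0; rewrite char_mod_ge0/= char_mod_le1//.
  by apply: mlxi; exact: ltW.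
- move=> s t s0 t0; have st0 : 0 <= s + t by rewrite addr_ge0// ltW.
  have mI : measurable_fun setT (fun w => xi (s + t) w - xi s w).
    by apply: measurable_funB; apply: mxi => //; exact: ltW.
  have mlI : measurable_fun setT (fun w => l * (xi (s + t) w - xi s w)).
    exact: measurable_funM.
  have -> : (fun w => l * xi (s + t) w) =
      (fun w => l * xi s w + l * (xi (s + t) w - xi s w)).
    by apply/funext => w; ring.
  rewrite char_mod_add//; [congr (_ * _)|by apply: mlxi; exact: ltW|].
    apply: char_mod_same_law => //; first by apply: mlxi; exact: ltW.
    move=> A mA.
    apply: (levy_stat_incr levy (ltW t0) (ltW s0) (A := [set x | A (l * x)])).
    by rewrite -[X in measurable X]setTI; exact: ml.
  move=> A B mA mB; apply: (levy_indep_incr levy (ltW t0) (ltW s0)).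
    apply: (sigma_of_gen _ xi s [set x | A (l * x)]).
      by rewrite /= (ltW s0) lexx.
    by rewrite -[X in measurable X]setTI; exact: ml.
  apply: (sigma_of_gen [set: unit] (fun _ w => xi (s + t) w - xi s w) tt
    [set x | B (l * x)]) => //.
  by rewrite -[X in measurable X]setTI; exact: ml.
- move=> t t0; rewrite (char_mod_same_law _ (fun w => 2 * (l * xi t w))).
  + by apply: char_mod_double; apply: mlxi; exact: ltW.
  + by apply: mlxi; rewrite mulr_ge0 ?powR_ge0// ltW.
  + by apply: measurable_funM => //; apply: mlxi; exact: ltW.
  + move=> A mA.
    have mlA : measurable [set x | A (l * x)].
      by rewrite -[X in measurable X]setTI; exact: ml.
    have := same_law_marginal _ _ _ _ _ t _ (scaling 2 (ltr0Sn R 1)) (ltW t0) mlA.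
    have -> : (fun w => 2 * (l * xi t w)) @^-1` A =
        (fun w => 2 * xi t w) @^-1` [set x | A (l * x)].
      by apply/seteqP; split => w /=; rewrite mulrCA.
    by [].
- move=> gam gam1.
  (* The mean cosine is below the modulus, so it suffices that it tends to 1 along the times [2^-n];
     right continuity at 0 and domination by 1 give this. *)
  have cvg1 : \int[P]_w cos (l * xi (2^-1 ^+ n) w) @[n --> \oo] --> (1 : R).
    have pow0 : (fun n => 2^-1 ^+ n : R) @ \oo --> (0 : R)^'+.
      move=> B [e /= e0 He]; have [n ne] := pow2_small e e0.
      exists n => // m /= nm; apply: He => /=; last by rewrite exprn_gt0.
      rewrite sub0r normrN gtr0_norm ?exprn_gt0// (le_lt_trans _ ne)//.
      by rewrite ler_wiXn2l// ?invr_ge0// invf_le1// ler1n.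
    have ptw w : (cos (l * xi (2^-1 ^+ n) w))%:E @[n --> \oo] --> 1%:E.
      apply: cvg_EFin; first by near=> n.
      have [_ /(_ 0 (lexx _)) rc _] := levy_cadlag levy w.
      rewrite (levy_start levy) in rc.
      have xi0 : xi (2^-1 ^+ n) w @[n --> \oo] --> (0 : R) := cvg_comp _ _ pow0 rc.
      have lxi0 : l * xi (2^-1 ^+ n) w @[n --> \oo] --> l * 0.
        by apply: cvgM => //; exact: cvg_cst.
      rewrite mulr0 in lxi0.
      by have := cvg_comp _ _ lxi0 (@continuous_cos R 0); rewrite cos0.
    have p20 n : 0 <= 2^-1 ^+ n :> R by rewrite exprn_ge0// invr_ge0.
    have [] := @dominated_convergence _ _ _ P setT measurableT
      (fun n w => (cos (l * xi (2^-1 ^+ n) w))%:E) (cst 1%E) (cst 1%E) => //.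
    - by move=> n; apply/measurable_EFinP/measurable_cos_comp/mlxi.
    - exact: aeW.
    - exact: integrable1.
    - by apply: aeW => w n _; rewrite lee_fin cos_max.
    move=> _ _ H; apply: fine_cvg.
    by move: H; rewrite integral_cst//= mul1e probability_setT.
  have /cvgrPdist_lt /(_ (1 - gam)) := cvg1.
  rewrite subr_gt0 => /(_ gam1) [n _ Hn]; exists (2^-1 ^+ n).
    by rewrite exprn_gt0.
  apply: le_trans (cosE_le_char_mod _ _).
  have := Hn n (leqnn n); rewrite /= => /(le_lt_trans (ler_norm _)).
  by rewrite ltrD2l ltrN2 => /ltW.
Unshelve. all: by end_near. Qed.

Lemma stable_above2_null : {ae P, forall w, xi 1 w = 0}.
Proof.
have mxi t : 0 <= t -> measurable_fun setT (xi t) by exact: levy_measurable levy t.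
have [k Hk] : exists k : R, {ae P, forall w, xi 1 w = k}.
  (* A modulus 1 determines [l * xi 1] only modulo [2 pi]. All the scales [2^-n] together remove the
     ambiguity: a nonzero difference [x] of two values would satisfy [0 < 2^-n |x| < 1 < pi] for
     some [n], where the cosine cannot be 1. *)
  have H n : exists pq : R * R, {ae P, forall w,
      cos (2^-1 ^+ n * xi 1 w) = pq.1 /\ sin (2^-1 ^+ n * xi 1 w) = pq.2}.
    have [|p [q pq]] := char_mod1 P _ _ (char_mod_scaling_eq1 (2^-1 ^+ n)).
      by apply: measurable_funM => //; exact: mxi.
    by exists (p, q).
  have [pq Hpq] := choice H.
  have {}Hpq := ae_foralln Hpq.
  have [w0 Hw0] : exists w0, forall n, cos (2^-1 ^+ n * xi 1 w0) = (pq n).1 /\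
      sin (2^-1 ^+ n * xi 1 w0) = (pq n).2.
    exact: (probability_ae_exists P _ Hpq).
  exists (xi 1 w0); apply: filterS Hpq => w Hw.
  apply/eqP; rewrite -subr_eq0; apply/negPn/negP => x0.
  set x := xi 1 w - xi 1 w0 in x0.
  have cos1 n : cos (2^-1 ^+ n * x) = 1.
    rewrite /x mulrBr cosB (Hw n).1 (Hw n).2 -(Hw0 n).1 -(Hw0 n).2.
    by rewrite -!expr2 cos2Dsin2.
  have nx0 : 0 < `|x| by rewrite normr_gt0.
  have [n ne] := pow2_small (`|x|^-1) (ltac:(by rewrite invr_gt0)).
  have y0 : 0 < 2^-1 ^+ n * `|x| by rewrite mulr_gt0// exprn_gt0.
  have y1 : 2^-1 ^+ n * `|x| < 1 by rewrite -ltr_pdivlMr// div1r.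
  have pi2 := pi_ge2 R.
  have E : 2^-1 ^+ n * `|x| = 0.
    apply: (@cos_inj R); rewrite ?in_itv/=; [lra|lra|].
    rewrite cos0 -[RHS](cos1 n) -[RHS]cos_norm normrM.
    by rewrite (ger0_norm (exprn_ge0 _ _))// invr_ge0.
  by move: y0; rewrite E ltxx.
(* The value at time 2 is [2^(1/alpha) k] by scaling and [2 k] by stationarity of increments, while
   [2^(1/alpha) < 2]. *)
suff k0 : k = 0 by rewrite -k0.
have c0 : 0 < (2 : R) `^ alpha^-1 by rewrite powR_gt0.
have a0 : 0 < alpha by exact: lt_trans alpha2.
have c2 : (2 `^ alpha^-1) `^ alpha = 2 :> R.
  by rewrite -powRrM mulVf ?gt_eqF// powRr1.
have mNk (z : R) : measurable (~` [set z]) by exact: measurableC.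
have ae_eqP (X : T -> R) z : measurable_fun setT X -> P (X @^-1` (~` [set z])) = 0%E ->
    {ae P, forall w, X w = z}.
  move=> mX X0; exists (X @^-1` (~` [set z])); split => //.
  by rewrite -[X in measurable X]setTI; exact: mX.
have H0 : P (xi 1 @^-1` (~` [set k])) = 0%E.
  apply: measure_negligible; last exact: Hk.
  by rewrite -[X in measurable X]setTI; exact: mxi.
have H2 : {ae P, forall w, xi 2 w = 2 `^ alpha^-1 * k}.
  apply: ae_eqP; first exact: mxi.
  have := same_law_marginal _ _ _ _ _ 1 _ (scaling _ c0) ler01 (mNk (2 `^ alpha^-1 * k)).
  rewrite /= c2 mulr1 => ->; rewrite -[RHS]H0; congr (P _).
  apply/seteqP; split => w /= H E; apply: H; first by rewrite E.
  by apply: (mulfI _ E); rewrite gt_eqF.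
have H2' : {ae P, forall w, xi (1 + 1) w - xi 1 w = k}.
  apply: ae_eqP.
    by apply: measurable_funB; apply: mxi => //; rewrite addr_ge0.
  by rewrite -[RHS]H0; apply: (levy_stat_incr levy ler01 ler01 (mNk k)).
have [w [E1 [E2 E3]]] : exists w, xi 1 w = k /\
    xi 2 w = 2 `^ alpha^-1 * k /\ xi (1 + 1) w - xi 1 w = k.
  apply: (probability_ae_exists P); apply: filterS2 Hk _ => [w E1 E23|].
    by split; first exact: E1; exact: E23.
  by apply: filterS2 H2 H2' => w E2 E3; split.
have c2lt : (2 : R) `^ alpha^-1 < 2.
  rewrite -ltr_ln ?posrE// ln_powR gtr_pMl ?ln_gt0 ?ltr1n// invf_lt1//.
  by rewrite (lt_trans _ alpha2)// ltr1n.
move: E3; rewrite E1 E2 => E3.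
have : (2 `^ alpha^-1 - 2) * k = 0 by lra.
by move/eqP; rewrite mulf_eq0 subr_eq0 (lt_eqF c2lt) => /eqP.
Qed.

End stable_above2.

Theorem proposition2p3 (R : realType) (d : measure_display)
    (T : measurableType d) (P : probability T R) (alpha : R)
    (S : R -> T -> nat -> \bar R) :
  0 < alpha -> branching_stable P alpha S ->
  (2 < alpha -> degenerate P (S 1)) /\
  (alpha <= 2 -> ~ degenerate P (S 1) ->
    exists2 xi : R -> T -> R, stable_levy_process P alpha xi &
      {ae P, forall w, forall t : R, 0 <= t -> S t w = single_atom (xi t w)}).
Proof.
move=> alpha0 bsS.
have [xi [levy scaling] Sxi] := exists_levy_process alpha0 bsS.
(* This implication serves both parts: directly above 2, and by contraposition to show that [xi] is
   not identically 0 when [S 1] is not degenerate. *)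
have deg : {ae P, forall w, xi 1 w = 0} -> degenerate P (S 1).
  move=> xi0; apply: filterS2 Sxi xi0 => w Sw xi0 k.
  by rewrite (Sw 1 ler01) xi0; case: k => //= k; rewrite eqxx.
split=> [alpha2|_ nondeg]; first exact/deg/(stable_above2_null alpha2 levy scaling).
exists xi => //; split => // xi0; apply/nondeg/deg.
by apply: filterS xi0 => w; apply.
Qed.
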